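(* Let $\beta>0$ and let $W:\Omega\to\mathbb{R}_+$ be a strict Lyapunov function of the form described in the context, associated with $\beta$ and functions $R$, $\kappa$. Then there exist a function $\sigma\in KL$ and a function $a\in K_\infty$ such that for every initial condition $(s(0),v(0))\in\Omega$ the solution $(s(t),v(t))\in\Omega$ of the microscopic inviscid ACC model is defined for all $t\ge 0$ and satisfies $$a\big(\mathrm{dist}((s(t),v(t)),S)\big)\le W(s(t),v(t))\le \sigma\big(W(s(0),v(0)),t\big)\quad\text{for all } t\ge 0.$$
   Context: Notation: $\mathbb{R}_+=[0,+\infty)$. $K_\infty$ is the class of (strictly) increasing continuous functions $a:\mathbb{R}_+\to\mathbb{R}_+$ with $a(0)=0$ and $\lim_{r\to+\infty}a(r)=+\infty$; $K$ is the class of (strictly) increasing continuous functions $a:\mathbb{R}_+\to\mathbb{R}_+$ with $a(0)=0$. $KL$ is the set of continuous functions $\sigma:\mathbb{R}_+\times\mathbb{R}_+\to\mathbb{R}_+$ such that for each $t\ge0$ the map $\sigma(\cdot,t)$ is of class $K$, and for each $r\ge 0$ the map $\sigma(r,\cdot)$ is non-increasing with $\lim_{t\to+\infty}\sigma(r,t)=0$. $\mathrm{dist}(x,A)=\inf\{|x-y|:y\in A\}$ is Euclidean distance to a set. Let $n\ge 2$ be an integer and let $\mu>0$, $\lambda>L>0$, $v_{\max}>v^*>0$ be constants. Let $V\in C^2((L,+\infty);\mathbb{R}_+)$ satisfy: $\lim_{s\to L^+}V(s)=+\infty$; $V''(s)\ge 0$ for all $s>L$; $V(s)=0$ for all $s\ge\lambda$;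 $V'(s)<0$ for all $s\in(L,\lambda)$. Let $f\in C^1(\mathbb{R})$ be non-decreasing with $\max(x,0)\le f(x)$ for all $x\in\mathbb{R}$, and define $$g(x)=\frac{v_{\max}f(x)}{v^*(v_{\max}-v^* )}-\frac{x}{v^*},\quad x\in\mathbb{R}.$$ Define $k_1(s_2)=\mu+g(-V'(s_2))$, $k_i(s_i,s_{i+1})=\mu+g(V'(s_i)-V'(s_{i+1}))$ for $i=2,\dots,n-1$, and $k_n(s_n)=\mu+g(V'(s_n))$. The microscopic inviscid ACC model, with state $(s,v)$, $s=(s_2,\dots,s_n)\in\mathbb{R}^{n-1}$, $v=(v_1,\dots,v_n)\in\mathbb{R}^n$, is the ODE system $$\dot s_i=v_{i-1}-v_i,\quad i=2,\dots,n,$$ $$\dot v_1=-k_1(s_2)(v_1-v^* )-V'(s_2),$$ $$\dot v_i=-k_i(s_i,s_{i+1})(v_i-v^* )+V'(s_i)-V'(s_{i+1}),\quad i=2,\dots,n-1,$$ $$\dot v_n=-k_n(s_n)(v_n-v^* )+V'(s_n),$$ with state space $$\Omega=\Big\{(s_2,\dots,s_n,v_1,\dots,v_n)\in\mathbb{R}^{2n-1}:\ \min_{i=2,\dots,n}s_i>L,\ \max_{i=1,\dots,n}v_i\le v_{\max},\ \min_{i=1,\dots,n}v_i\ge 0\Big\}.$$ Its set of equilibrium points is $$S=\Big\{(s_2,\dots,s_n,v_1,\dots,v_n)\in\mathbb{R}^{2n-1}:\ \min_{i=2,\dots,n}s_i\ge\lambda,\ v_i=v^*,\ i=1,\dots,n\Big\}\subset\Omega.$$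 Define $H:\Omega\to\mathbb{R}_+$ by $H(s,v)=\frac12\sum_{i=1}^n(v_i-v^* )^2+\sum_{i=2}^nV(s_i)$. The function $W$: $R\in C^1(\mathbb{R}_+;(0,+\infty))$ and $\kappa\in C^0(\mathbb{R}_+;(0,+\infty))$ are non-decreasing functions such that, with $$W(s,v):=R(H(s,v))\,H(s,v)-\sum_{i=2}^n4^i\,V'(s_i)(v_i-v^* ),\quad (s,v)\in\Omega,$$ the following hold for all $(s,v)\in\Omega$: $$H(s,v)\le W(s,v)\le\kappa(H(s,v))H(s,v),$$ $$\dot W(s,v)\le-\beta\mu\sum_{i=1}^n(v_i-v^* )^2-\frac18\sum_{i=2}^n4^i(V'(s_i))^2,$$ where $\dot W(s,v)=\sum_{i=2}^n\frac{\partial W}{\partial s_i}(s,v)\,(v_{i-1}-v_i)+\sum_{i=1}^n\frac{\partial W}{\partial v_i}(s,v)\,F_i(s,v)$ is the time derivative of $W$ along solutions, $F_i(s,v)$ being the right-hand side of the $\dot v_i$ equation above. (For every $\beta>0$ such $R$ and $\kappa$ exist.) *)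

(* Defs.v *)
From HB Require Import structures.
From mathcomp Require Import all_boot all_order all_algebra.
From mathcomp Require Import all_classical all_reals all_analysis.

Set Implicit Arguments.
Unset Strict Implicit.
Unset Printing Implicit Defensive.

Import Order.TTheory GRing.Theory Num.Theory.
Import numFieldNormedType.Exports.

Local Open Scope ring_scope.
Local Open Scope classical_set_scope.

(* Functions on R_+ are total functions R -> R of which only the values on
   [0, +oo[ are ever used. *)
Notation Rnneg := `[0, +oo[%classic.

Definition nondecreasing_on {R : realType} (A : set R) (h : R -> R) : Prop :=
  forall r1 r2, A r1 -> A r2 -> r1 <= r2 -> h r1 <= h r2.

Definition class_K {R : realType} (a : R -> R) : Prop :=
  [/\ forall r, Rnneg r -> 0 <= a r,
      {within Rnneg, continuous a},
      forall r1 r2, Rnneg r1 -> Rnneg r2 -> r1 < r2 -> a r1 < a r2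
    & a 0 = 0].

Definition class_Kinfty {R : realType} (a : R -> R) : Prop :=
  class_K a /\ (a r @[r --> +oo] --> +oo).

Definition class_KL {R : realType} (sigma : R -> R -> R) : Prop :=
  [/\ forall r t, Rnneg r -> Rnneg t -> 0 <= sigma r t,
      {within Rnneg `*` Rnneg, continuous (fun p : R * R => sigma p.1 p.2)},
      forall t, Rnneg t -> class_K (fun r => sigma r t),
      forall r t1 t2, Rnneg r -> Rnneg t1 -> Rnneg t2 -> t1 <= t2 ->
        sigma r t2 <= sigma r t1
    & forall r, Rnneg r -> sigma r t @[t --> +oo] --> (0 : R)].

(* h has derivative l at t relative to A; the derivative is one-sided when t is
   an endpoint of the interval A. *)
Definition has_derivative_within {R : realType} (A : set R) (h : R -> R)
    (t l : R) : Prop :=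
  (h u - h t) / (u - t) @[u --> within A t^'] --> l.

Definition C1_within {R : realType} (A : set R) (h : R -> R) : Prop :=
  exists2 h' : R -> R, {within A, continuous h'} &
    forall t, A t -> has_derivative_within A h t (h' t).

Definition C2_right_of {R : realType} (L : R) (V : R -> R) : Prop :=
  forall s, L < s ->
    [/\ derivable V s 1, derivable (derive1 V) s 1 & {for s, continuous (derive1 (derive1 V))}].

(* A point (s_2, ..., s_n, v_1, ..., v_n) of R^(2n-1).  The entries of the two
   row vectors are numbered from 0, whereas [gap x i] and [vel x i] are s_i
   (2 <= i <= n) and v_i (1 <= i <= n). *)
Definition state (R : realType) (n : nat) : Type :=
  ('rV[R]_n.-1 * 'rV[R]_n)%type.

Definition entry {R : realType} {m : nat} (w : 'rV[R]_m) (k : nat) : R :=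
  if insub k is Some j then w 0 j else 0.

Definition gap {R : realType} {n : nat} (x : state R n) (i : nat) : R :=
  entry x.1 (i - 2).

Definition vel {R : realType} {n : nat} (x : state R n) (i : nat) : R :=
  entry x.2 (i - 1).

Definition gap_dir {R : realType} {n : nat} (i : nat) : state R n :=
  (\row_j (j == (i - 2)%N :> nat)%:R, 0).

Definition vel_dir {R : realType} {n : nat} (i : nat) : state R n :=
  (0, \row_j (j == (i - 1)%N :> nat)%:R).

Definition enorm {R : realType} {n : nat} (x : state R n) : R :=
  Num.sqrt (\sum_j (x.1 0 j) ^+ 2 + \sum_j (x.2 0 j) ^+ 2).

Definition dist {R : realType} {n : nat} (x : state R n)
    (A : set (state R n)) : R :=
  inf [set enorm (x - y) | y in A].

Definition g {R : realType} (vmax vstar : R) (f : R -> R) (x : R) : R :=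
  vmax * f x / (vstar * (vmax - vstar)) - x / vstar.

(* The potential term of the equation for v_i; it is also the argument of g
   in k_i. *)
Definition force {R : realType} {n : nat} (V : R -> R) (x : state R n)
    (i : nat) : R :=
  if i == 1%N then - derive1 V (gap x 2)
  else if i == n then derive1 V (gap x n)
  else derive1 V (gap x i) - derive1 V (gap x i.+1).

Definition k {R : realType} {n : nat} (mu vmax vstar : R) (V f : R -> R)
    (x : state R n) (i : nat) : R :=
  mu + g vmax vstar f (force V x i).

Definition F {R : realType} {n : nat} (mu vmax vstar : R) (V f : R -> R)
    (x : state R n) (i : nat) : R :=
  - k mu vmax vstar V f x i * (vel x i - vstar) + force V x i.

(* The points at which the right-hand side of the model is defined: V is given
   on (L, +oo) only. *)
Definition ode_domain {R : realType} (n : nat) (L : R) : set (state R n) :=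
  [set x | forall i, (2 <= i <= n)%N -> L < gap x i].

Definition Omega {R : realType} (n : nat) (L vmax : R) : set (state R n) :=
  [set x | (forall i, (2 <= i <= n)%N -> L < gap x i) /\
           (forall i, (1 <= i <= n)%N -> 0 <= vel x i <= vmax)].

Definition equilibria {R : realType} (n : nat) (lambda vstar : R) :
    set (state R n) :=
  [set x | (forall i, (2 <= i <= n)%N -> lambda <= gap x i) /\
           (forall i, (1 <= i <= n)%N -> vel x i = vstar)].

Definition is_solution {R : realType} {n : nat} (L mu vmax vstar : R)
    (V f : R -> R) (I : set R) (x : R -> state R n) : Prop :=
  forall t, I t ->
    [/\ ode_domain L (x t),
        forall i, (2 <= i <= n)%N ->
          has_derivative_within I (fun u => gap (x u) i) t
            (vel (x t) i.-1 - vel (x t) i)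
      & forall i, (1 <= i <= n)%N ->
          has_derivative_within I (fun u => vel (x u) i) t
            (F mu vmax vstar V f (x t) i)].

Definition H {R : realType} {n : nat} (vstar : R) (V : R -> R)
    (x : state R n) : R :=
  2^-1 * \sum_(1 <= i < n.+1) (vel x i - vstar) ^+ 2
  + \sum_(2 <= i < n.+1) V (gap x i).

Definition W {R : realType} {n : nat} (vstar : R) (V rho : R -> R)
    (x : state R n) : R :=
  rho (H vstar V x) * H vstar V x
  - \sum_(2 <= i < n.+1) 4 ^+ i * derive1 V (gap x i) * (vel x i - vstar).

(* The formula for U may be evaluated on all of [ode_domain], which is open, so
   the two-sided partial derivatives below also make sense at the points of
   Omega with some v_i equal to 0 or vmax. *)
Definition orbital_derivative {R : realType} {n : nat} (mu vmax vstar : R)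
    (V f : R -> R) (U : state R n -> R) (x : state R n) : R :=
  \sum_(2 <= i < n.+1) 'D_(gap_dir i) U x * (vel x i.-1 - vel x i)
  + \sum_(1 <= i < n.+1) 'D_(vel_dir i) U x * F mu vmax vstar V f x i.

(* Main.v *)
(* Convexity of V gives V <= (lambda - L) |V'|, hence the dissipation bound
   controls H ^ 2 and, on sublevel sets of W, also W ^ 2.  Therefore
   (1 / W)' >= gam(W(0)) along solutions, which gives the explicit KL bound
   W(t) <= W(0) / (1 + gam(W(0)) W(0) t).

   For existence, fix an initial point and l > L with V(l) > W(0).  Cutting the
   gaps off at l and the velocities to [0, vmax] makes the vector field bounded
   and globally Lipschitz, so that Picard iteration solves it on R_+.  The
   velocities stay in [0, vmax] because the acceleration points inwards there,
   and the gaps stay above l because V(s_i) <= H <= W <= W(0) < V(l) as long as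
   they do; hence the cut-offs are never active.  A competing solution obeys the
   same bounds, and therefore solves the truncated equation as well, which has
   unique solutions. *)
Require Import Defs.
From HB Require Import structures.
From mathcomp Require Import all_boot all_order all_algebra.
From mathcomp Require Import all_classical all_reals all_analysis.
From mathcomp Require Import ring lra zify.

Import Order.TTheory GRing.Theory Num.Theory.
Import numFieldNormedType.Exports.

Local Open Scope ring_scope.
Local Open Scope classical_set_scope.

Set Implicit Arguments.
Unset Strict Implicit.
Unset Printing Implicit Defensive.

(** * One-sided derivatives and comparison principles *)

(** The dissipation bound is available only inside Omega and along the true model, whereas remaining
    in Omega is itself deduced from the decay of W. The circle is broken in two stages. The sign of
    the acceleration for v <= 0 and for v >= [vmax] does not depend on the force, by the choice of
    g, so the velocity bounds need no information on the gaps. The gaps are then handled by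
    continuous induction: while they are at least l, the truncated and the true fields agree, W has
    not increased, and hence the gaps exceed l strictly.

    The dissipation controls H^2 and not H, because V need not be bounded by a multiple of V'^2:
    (lambda - s)^3 to the left of lambda is a counterexample. This is why the decay obtained is of
    order 1/t rather than exponential.

    The function a comes from H <= W and a lower bound of H by the distance: a state far from S has
    either a velocity far from [vstar] or a gap well below lambda, where V is positive and
    nonincreasing. *)

Lemma has_derivative_within_subset {R : realType} (A B : set R) (h : R -> R)
    (t l : R) :
  A `<=` B -> has_derivative_within B h t l -> has_derivative_within A h t l.
Proof.
move=> AB /cvgrPdist_le hl; apply/cvgrPdist_le => e /hl; rewrite !near_withinE.
by apply: filterS => u Bu ut /AB; exact: Bu.
Qed.

Lemma has_derivative_within_nbhs {R : realType} (A : set R) (h : R -> R)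
    (t l : R) :
  nbhs t A -> has_derivative_within A h t l ->
  has_derivative_within setT h t l.
Proof.
move=> tA /cvgrPdist_le hl; apply/cvgrPdist_le => e /hl; rewrite !near_withinE.
by move: tA; apply: filterS2 => u Au /[swap] ut /(_ ut Au).
Qed.

(** The difference quotient, completed by l at t, is the Caratheodory factor of h, and its
    continuity at t is the convergence of the quotient. *)
Lemma has_derivative_withinTP {R : realType} (h : R -> R) (t l : R) :
  has_derivative_within setT h t l <-> is_derive t 1 h l.
Proof.
rewrite is_derive1_caratheodory; split=> [hl|[q [hq qt ql]]].
- exists (fun z => if z == t then l else (h z - h t) / (z - t)).
  rewrite eqxx; split=> // [z|].
    have [->|zt] := eqVneq z t; first by rewrite !subrr mulr0.
    by rewrite divfK// subr_eq0.
  apply/continuous_withinNx/cvgrPdist_le => e; move/cvgrPdist_le : hl => /[apply].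
  rewrite eqxx !near_withinE; apply: filterS => u + ut => /(_ ut I).
  by rewrite (negbTE ut).
- have /continuous_withinNx/cvgrPdist_le := qt; rewrite ql => ht.
  apply/cvgrPdist_le => e /ht; rewrite !near_withinE; apply: filterS => u + ut _.
  by rewrite hq mulfK ?subr_eq0//; exact.
Qed.

Lemma has_derivative_within_interior {R : realType} (A : set R) (h : R -> R)
    (t l : R) :
  nbhs t A -> has_derivative_within A h t l -> is_derive t 1 h l.
Proof.
by move=> tA hl; apply/has_derivative_withinTP; exact: has_derivative_within_nbhs hl.
Qed.

Lemma is_derive_within {R : realType} (A : set R) (h : R -> R) (t l : R) :
  is_derive t 1 h l -> has_derivative_within A h t l.
Proof.
move=> /has_derivative_withinTP; exact: has_derivative_within_subset.
Qed.

Lemma is_derive1_continuous {R : realType} (h : R -> R) (t l : R) :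
  is_derive t 1 h l -> {for t, continuous h}.
Proof.
by move=> [hl _]; apply: differentiable_continuous; exact/derivable1_diffP.
Qed.

(* Lets solutions on [0, T[ be treated as curves with two-sided derivatives,
   also at time 0. *)
Lemma tangent_extension {R : realType} (T : R) (h : R -> R) (l : R -> R) :
  (forall t, `[0, T[%classic t -> has_derivative_within `[0, T[ h t (l t)) ->
  forall t, 0 <= t < T ->
    is_derive t 1 (fun u => if 0 <= u then h u else h 0 + u * l 0) (l t).
Proof.
move=> hl t /andP[]; rewrite le_eqVlt => /predU1P[<-|t0] tT; last first.
  apply: (@near_eq_is_derive _ _ _ h).
    by near=> u; rewrite ifT//; near: u; exact: lt_le_nbhsr.
  apply: (@has_derivative_within_interior _ `[0, T[).
    by near=> u; rewrite /= in_itv/=; apply/andP; split; near: u;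
      [exact: lt_le_nbhsr|exact: lt_nbhsl].
  by apply: hl; rewrite /= in_itv/= ltW.
apply/has_derivative_withinTP.
have /hl/cvgrPdist_le h0 : `[0, T[%classic 0 by rewrite /= in_itv/= lexx.
apply/cvgrPdist_le => e e0; have := h0 _ e0.
rewrite !near_withinE => h0e; near=> u => u0 _.
rewrite lexx; case: ifPn => [u_ge0|].
  apply: (near h0e u) => //=; rewrite in_itv/= u_ge0/=.
  by near: u; exact: lt_nbhsl.
by rewrite -ltNge => ult0; rewrite addrAC subrr add0r subr0 mulrAC divff// mul1r subrr
  normr0 ltW.
Unshelve. all: by end_near. Qed.

Lemma is_derive_mull {R : realType} (c t : R) :
  is_derive t 1 (fun s => c * s) c.
Proof.
apply/is_derive1_caratheodory; exists (fun=> c); split=> // [z|].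
  by rewrite mulrBr.
exact: cvg_cst.
Qed.

Lemma is_derive_ler {R : realType} (a t : R) (D E D' E' : R -> R) :
  a <= t ->
  (forall u, a <= u <= t -> {for u, continuous D}) ->
  (forall u, a <= u <= t -> {for u, continuous E}) ->
  (forall u, a < u < t -> is_derive u 1 D (D' u)) ->
  (forall u, a < u < t -> is_derive u 1 E (E' u)) ->
  (forall u, a < u < t -> D' u <= E' u) ->
  D t - D a <= E t - E a.
Proof.
move=> at_ cD cE dD dE DE.
have [->|tna] := eqVneq t a; first by rewrite !subrr.
have {tna}at' : a < t by rewrite lt_neqAle eq_sym tna.
have [||c' /[!in_itv]/= c0t'] :=
  @MVT R (fun u => D u - E u) (fun u => D' u - E' u) a t at'.
- move=> u; rewrite in_itv/= => u0t.
  by apply: is_deriveB; [exact: dD|exact: dE].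
- apply: continuous_in_subspaceT => u; rewrite inE/= in_itv/= => u0t.
  by apply: cvgB; [exact: cD|exact: cE].
move=> eq1; have := DE _ c0t'; rewrite -subr_le0 => le0.
have : (D' c' - E' c') * (t - a) <= 0.
  by rewrite mulr_le0_ge0// subr_ge0.
by move: eq1; lra.
Qed.

(** The majorant is itself a derivative rather than a constant, so that E can be the exponential
    weight of the Picard estimates. *)
Lemma is_derive_ler_norm {R : realType} (a t : R) (D E D' E' : R -> R) :
  a <= t ->
  (forall u, a <= u <= t -> {for u, continuous D}) ->
  (forall u, a <= u <= t -> {for u, continuous E}) ->
  (forall u, a < u < t -> is_derive u 1 D (D' u)) ->
  (forall u, a < u < t -> is_derive u 1 E (E' u)) ->
  (forall u, a < u < t -> `|D' u| <= E' u) ->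
  `|D t - D a| <= E t - E a.
Proof.
move=> at_ cD cE dD dE DE; rewrite ler_norml; apply/andP; split; last first.
  apply: (is_derive_ler at_ cD cE dD dE) => u /DE.
  exact: le_trans (ler_norm _).
suff : - D t - - D a <= E t - E a by lra.
apply: (@is_derive_ler _ _ _ (fun u => - D u) _ (fun u => - D' u) _ at_ _ cE _ dE).
- by move=> u /cD; exact: cvgN.
- by move=> u /dD; exact: is_deriveN.
- by move=> u /DE; apply: le_trans; rewrite -normrN ler_norm.
Qed.

(** If the minimum over [0, t] were negative, it would be attained at some c > 0; a positive
    derivative at c then yields smaller values just to the left of c. *)
Lemma ge0_barrier {R : realType} (t : R) (h h' : R -> R) :
  0 <= t -> 0 <= h 0 ->
  (forall u, 0 <= u <= t -> is_derive u 1 h (h' u)) ->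
  (forall u, 0 <= u <= t -> h u < 0 -> 0 < h' u) ->
  0 <= h t.
Proof.
move=> t0 h0 dh pos.
have ch : {within `[0, t], continuous h}.
  apply: continuous_in_subspaceT => u; rewrite inE/= in_itv/= => u0t.
  exact: is_derive1_continuous (dh _ u0t).
have [c /[!in_itv]/= ct min] := EVT_min t0 ch.
apply: (@le_trans _ _ (h c)); last by apply: min; rewrite in_itv/= t0 lexx.
rewrite leNgt; apply/negP => hc.
have c0 : 0 < c.
  rewrite lt_neqAle; move: ct => /andP[-> _]; rewrite andbT.
  by apply: contraTneq hc => <-; rewrite -leNgt.
have /is_derive1_caratheodory[q [hq cq qc]] := dh _ ct.
have qpos : \forall z \near c^'-, 0 < q z.
  by apply: cvg_within; apply: (cvgr_gt _ cq); rewrite qc; exact: pos.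
have : \forall z \near c^'-, h z < h c.
  near=> z; rewrite -subr_lt0 hq pmulr_rlt0 ?subr_lt0; last by near: z.
  by near: z; exact: nbhs_left_lt.
move=> hlt.
near c^'- => z.
suff : h c <= h z by rewrite leNgt => /negP; apply; near: z.
apply: min; rewrite in_itv/=; apply/andP; split.
  by near: z; exact: nbhs_left_ge.
move: ct => /andP[_]; apply: le_trans; rewrite ltW//.
Unshelve. all: by end_near. Qed.

(** Continuous induction up to the infimum b of the bad times. The strict bounds before b give weak
    bounds at b by continuity, [step] makes them strict at b, and finiteness of J spreads them to a
    neighbourhood of b, which therefore contains no bad time. *)
Lemma gt_barrier {R : realType} (J : finType) (P : pred J) (s : J -> R -> R)
    (l : R) :
  (forall j t, P j -> 0 <= t -> {for t, continuous (s j)}) ->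
  (forall j, P j -> l < s j 0) ->
  (forall t, 0 <= t ->
    (forall u, 0 <= u <= t -> forall j, P j -> l <= s j u) ->
    forall j, P j -> l < s j t) ->
  forall t, 0 <= t -> forall j, P j -> l < s j t.
Proof.
move=> cs s0 step.
pose B := [set t | 0 <= t /\ ~ (forall j, P j -> l < s j t)].
have B_lb : lbound B 0 by move=> u [].
have [B0 t t0|B0] := pselect (B = set0).
  by apply: contrapT => nP; have : B t by []; rewrite B0.
have infB : has_inf B by split; [apply/set0P/eqP|exists 0].
set b := inf B.
have b0 : 0 <= b by apply: lb_le_inf => //; case: infB.
have ltb u : 0 <= u < b -> forall j, P j -> l < s j u.
  move=> /andP[u0 ub]; apply: contrapT => nP.
  suff : b <= u by rewrite leNgt ub.
  exact: ge_inf infB.2 _ (conj u0 nP).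
have leb u : 0 <= u <= b -> forall j, P j -> l <= s j u.
  move=> /andP[u0]; rewrite le_eqVlt => /predU1P[->|ub] j Pj; last first.
    by rewrite ltW// ltb// u0.
  move: b0; rewrite le_eqVlt => /predU1P[<-|b0]; first by rewrite ltW// s0.
  rewrite leNgt; apply/negP => sl.
  have sl' : \forall z \near b^'-, s j z < l.
    by apply: cvg_within; apply: (cvgr_lt _ (cs _ _ Pj (ltW b0))).
  near b^'- => z.
  suff : l < s j z by rewrite ltNge ltW//; near: z.
  apply: ltb => //; apply/andP; split.
    by near: z; exact: nbhs_left_ge.
  by near: z; exact: nbhs_left_lt.
have sb := step _ b0 leb.
have : \forall z \near b, forall j, P j -> l < s j z.
  apply: (@filter_forall _ _ (fun j z => P j -> l < s j z) (nbhs b)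
    (nbhs_filter b)) => j.
  case: (boolP (P j)) => [Pj|]; last first.
    by move=> _; near=> z.
  near=> z => _; near: z; apply: (cvgr_gt _ (cs _ _ Pj b0)); exact: sb.
move=> /nbhs_ballP[e /= e0 be].
have [x [x0 nPx] xb] := inf_adherent e0 infB.
have bx : b <= x := ge_inf infB.2 (conj x0 nPx).
exfalso; apply: nPx; apply: be; rewrite /ball/= ltr_norml.
by rewrite -/b in xb; lra.
Unshelve. all: by end_near. Qed.

(** * Antiderivatives, geometric limits and elementary Lipschitz bounds *)

(** The integral starts at -1 so that 0 is an interior point and the derivative there is
    two-sided. *)
Lemma continuous_antiderivative {R : realType} (q : R -> R) :
  continuous q ->
  exists G : R -> R, G 0 = 0 /\ forall t : R, -1 < t -> is_derive t 1 G (q t).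
Proof.
move=> cq.
pose G x := (\int[lebesgue_measure]_(t in `[-1, x]) q t)%R.
exists (fun x => G x - G 0); rewrite subrr; split=> // t t1.
rewrite -[q t]subr0; apply: is_deriveB.
have tt1 : t < t + 1 by rewrite ltrDl.
have iq : lebesgue_measure.-integrable `[-1, t + 1] (EFin \o q).
  apply: continuous_compact_integrable; first exact: segment_compact.
  exact: continuous_subspaceT.
have [dG <-] := continuous_FTC1_closed tt1 iq t1 (cq t).
by rewrite derive1E; exact: derivableP.
Qed.

Lemma lipschitz_continuous1 {R : realType} (C : R) (h : R -> R) :
  (forall s t, `|h s - h t| <= C * `|s - t|) -> continuous h.
Proof.
move=> hC t; apply/cvgrPdist_lt => e e0.
have C0 : 0 <= C.
  by have := le_trans (normr_ge0 _) (hC 1 0); rewrite subr0 normr1 mulr1.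
(* C may be 0, hence the division by C + 1. *)
have C1 : 0 < C + 1 by lra.
near=> s; apply: le_lt_trans (hC _ _) _.
apply: (@le_lt_trans _ _ ((C + 1) * `|t - s|)).
  by apply: ler_wpM2r => //; lra.
rewrite -ltr_pdivlMl//; near: s.
by apply: cvgr_dist_lt => //; rewrite mulr_gt0 ?invr_gt0.
Unshelve. all: by end_near. Qed.

Lemma is_derive_expRM {R : realType} (c b t : R) :
  is_derive t 1 (fun s => c * expR (b * s)) (c * (b * expR (b * t))).
Proof.
have bt : is_derive t (1 : R) (fun s => b * s) b := is_derive_mull _ _.
have := is_deriveZ c (is_derive1_comp (is_derive_expR _) bt).
by rewrite mulrC.
Qed.

(** Replaces a passage to the limit: if a > b, some k has 1 / 2^k < (a - b) / c, against the
    hypothesis. *)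
Lemma le_halving {R : realType} (a b c : R) :
  (forall k : nat, a <= b + c / 2 ^+ k) -> a <= b.
Proof.
move=> h; rewrite leNgt; apply/negP => ba.
have [c0|c0] := leP c 0; first by have := h 0%N; rewrite expr0 divr1; lra.
have e0 : 0 < (a - b) / c by rewrite divr_gt0// subr_gt0.
have [k _ /(_ k (leqnn k))/=] := near_infty_natSinv_expn_lt (PosNum e0).
rewrite div1r ltr_pdivlMr// mulrC => hk; have := h k; lra.
Qed.

(** The intervals of radius 2c / 2^k around a(k) are nested, since the tail of the increments is at
    most that radius. The supremum of their left ends lies in all of them. *)
Lemma halving_limit {R : realType} (a : nat -> R) (c : R) :
  (forall k, `|a k.+1 - a k| <= c / 2 ^+ k) ->
  exists l, forall k, `|l - a k| <= 2 * c / 2 ^+ k.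
Proof.
move=> ac.
pose up k := a k + 2 * c / 2 ^+ k; pose lo k := a k - 2 * c / 2 ^+ k.
have half k : 2 * c / 2 ^+ k.+1 = c / 2 ^+ k.
  by rewrite exprS invfM mulrACA divff// mul1r.
have c0 k : 0 <= c / 2 ^+ k by exact: le_trans (normr_ge0 _) (ac k).
have upS k : up k.+1 <= up k.
  by have := ac k; rewrite /up half -mulrA ler_norml; lra.
have loS k : lo k <= lo k.+1.
  by have := ac k; rewrite /lo half -mulrA ler_norml; lra.
have lo_up i m : lo i <= up m.
  apply: (@le_trans _ _ (lo (maxn i m))).
    by have /nondecreasing_seqP := loS; apply; exact: leq_maxl.
  apply: (@le_trans _ _ (up (maxn i m))).
    by have := c0 (maxn i m); rewrite /lo /up -mulrA; lra.
  by have /nonincreasing_seqP := upS; apply; exact: leq_maxr.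
have lo_ub m : ubound (range lo) (up m) by move=> _ [i _ <-].
exists (sup (range lo)) => k.
have : lo k <= sup (range lo).
  by apply: ub_le_sup; [exists (up 0%N)|exists k].
have : sup (range lo) <= up k by apply: ge_sup; first by exists (lo 0%N); exists 0%N.
by rewrite /lo /up ler_norml; lra.
Qed.

Lemma ler_norm_max {R : realDomainType} (c s t : R) :
  `|Num.max s c - Num.max t c| <= `|s - t|.
Proof.
have := ler_norm (s - t); have := ler_norm (t - s); rewrite distrC ler_norml.
by rewrite /Num.max; do 2 case: ifP => ?; lra.
Qed.

Lemma ler_norm_min {R : realDomainType} (c s t : R) :
  `|Num.min s c - Num.min t c| <= `|s - t|.
Proof.
have := ler_norm (s - t); have := ler_norm (t - s); rewrite distrC ler_norml.
by rewrite /Num.min; do 2 case: ifP => ?; lra.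
Qed.

Lemma max_continuous {R : realType} (c : R) :
  continuous (fun u : R => Num.max u c).
Proof.
by apply: (@lipschitz_continuous1 _ 1) => u v; rewrite mul1r ler_norm_max.
Qed.

Lemma min_continuous {R : realType} (c : R) :
  continuous (fun u : R => Num.min u c).
Proof.
by apply: (@lipschitz_continuous1 _ 1) => u v; rewrite mul1r ler_norm_min.
Qed.

(** * Global Picard iteration *)

Section Picard.
Context {R : realType} {J : Type}.
Variables (Phi : (J -> R) -> J -> R) (K M : R).
Hypothesis K_gt0 : 0 < K.
Hypothesis Phi_bounded : forall x j, `|Phi x j| <= M.
(** A Lipschitz condition for the sup norm, phrased through a common bound d because J is an
    arbitrary type. *)
Hypothesis Phi_lipschitz : forall x y d, (forall j, `|x j - y j| <= d) ->
  forall j, `|Phi x j - Phi y j| <= K * d.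

Let M_ge0 (j : J) : 0 <= M := le_trans (normr_ge0 _) (Phi_bounded (fun=> 0) j).

(** As M bounds Phi, this class of curves is stable under the Picard operator, and inside it the
    integrand is continuous. *)
Let lipschitz (u : J -> R -> R) :=
  forall j s t, `|u j s - u j t| <= M * `|s - t|.

Let Phi_along u (j : J) (t : R) := Phi (u ^~ t) j.

Let Phi_along_continuous u : lipschitz u -> forall j, continuous (Phi_along u j).
Proof.
move=> uM j; apply: (@lipschitz_continuous1 _ (K * M)) => s t.
by rewrite -mulrA; apply: Phi_lipschitz => i; exact: uM.
Qed.

(* Bielecki's weight exp(2Kt) makes the Picard operator a contraction of ratio
   1/2 on the whole half-line. *)
Let weighted_contraction (D D' : R -> R) (c t : R) : 0 <= c -> 0 <= t ->
  D 0 = 0 ->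
  (forall s, 0 <= s <= t -> {for s, continuous D}) ->
  (forall s, 0 < s < t -> is_derive s 1 D (D' s)) ->
  (forall s, 0 < s < t -> `|D' s| <= K * (c * expR (2 * K * s))) ->
  `|D t| <= c / 2 * expR (2 * K * t).
Proof.
move=> c0 t0 D0 cD dD D'K.
have dE (s : R) := @is_derive_expRM R (c / 2) (2 * K) s.
have := is_derive_ler_norm t0 cD (fun s _ => is_derive1_continuous (dE s)) dD
  (fun s _ => dE s).
rewrite D0 subr0 mulr0 expR0 mulr1 => /(_ _)/le_trans; apply.
  by move=> s /D'K /le_trans; apply; rewrite le_eqVlt; apply/predU1P; left; field.
by rewrite gerBl divr_ge0.
Qed.

(** Starts the inductions of both theorems below: the initial discrepancy grows at most linearly,
    and 1 + x <= exp x puts it under the weight. *)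
Let linear_le_weight (r : R) : 0 <= M -> 0 <= r ->
  2 * M * r <= M / K * expR (2 * K * r).
Proof.
move=> M0 r0; apply: (@le_trans _ _ (M / K * (1 + 2 * K * r))).
  have -> : M / K * (1 + 2 * K * r) = M / K + 2 * M * r.
    by field; rewrite gt_eqF.
  by rewrite lerDr divr_ge0// ltW.
by rewrite ler_wpM2l ?divr_ge0 ?expR_ge1Dx// ltW.
Qed.

(** The crude bound 2Mt on the difference is fed repeatedly into the weighted contraction, each pass
    halving its constant. *)
Lemma picard_unique (T : R) (u w : J -> R -> R) :
  (forall j, u j 0 = w j 0) ->
  (forall j (t : R), 0 <= t < T -> is_derive t 1 (u j) (Phi (u ^~ t) j)) ->
  (forall j (t : R), 0 <= t < T -> is_derive t 1 (w j) (Phi (w ^~ t) j)) ->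
  forall j (t : R), 0 <= t < T -> u j t = w j t.
Proof.
move=> uw0 du dw j t t0T.
have lt0T (s r : R) : 0 <= r < T -> 0 <= s <= r -> 0 <= s < T.
  by move=> /andP[_ rT] /andP[-> /le_lt_trans->].
have dD i (s : R) : 0 <= s < T -> is_derive s 1 (u i \- w i)
    (Phi (u ^~ s) i - Phi (w ^~ s) i).
  by move=> sT; apply: is_deriveB; [exact: du|exact: dw].
have D0 i : (u i \- w i) 0 = 0 by rewrite /= uw0 subrr.
have cD i (s r : R) : 0 <= r < T -> 0 <= s <= r -> {for s, continuous (u i \- w i)}.
  by move=> rT /(lt0T _ _ rT) sT; exact: is_derive1_continuous (dD i s sT).
have dD' i (s r : R) : 0 <= r < T -> 0 < s < r -> is_derive s 1 (u i \- w i)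
    (Phi (u ^~ s) i - Phi (w ^~ s) i).
  by move=> rT /andP[s0 sr]; apply: dD; apply: lt0T rT _; rewrite !ltW.
have bound k : forall i r, 0 <= r < T ->
    `|(u i \- w i) r| <= M / K / 2 ^+ k * expR (2 * K * r).
  elim: k => [|k ih] i r rT; have /andP[r0 _] := rT.
    have dE (s : R) := is_derive_mull (2 * M) s.
    have := is_derive_ler_norm r0 (fun s => @cD i s r rT)
      (fun s _ => is_derive1_continuous (dE s)) (fun s => @dD' i s r rT)
      (fun s _ => dE s).
    rewrite D0 mulr0 !subr0 => /(_ _)/le_trans; apply.
      move=> s _; apply: le_trans (ler_normB _ _) _.
      by rewrite mulr2n mulrDl mul1r lerD.
    by rewrite expr0 divr1; exact: linear_le_weight (M_ge0 i) r0.
  rewrite exprSr invfM mulrA.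
  apply: (@weighted_contraction _ (fun s => Phi (u ^~ s) i - Phi (w ^~ s) i)) => //.
  - by rewrite !divr_ge0 ?exprn_ge0 ?(M_ge0 i)// ltW.
  - by move=> s; exact: cD.
  - by move=> s; exact: dD'.
  - move=> s /andP[s0 sr]; apply: Phi_lipschitz => l.
    by apply: ih; apply: lt0T rT _; rewrite !ltW.
apply/eqP; rewrite -subr_eq0 -normr_le0.
apply/(@le_halving _ _ _ (M / K * expR (2 * K * t))) => k.
by rewrite add0r mulrAC; exact: bound.
Qed.

Theorem picard_exists (x0 : J -> R) :
  exists u : J -> R -> R, (forall j, u j 0 = x0 j) /\
    forall j (t : R), 0 <= t -> is_derive t 1 (u j) (Phi (u ^~ t) j).
Proof.
(* A picks an antiderivative vanishing at 0 for every continuous q; its value at any other q is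
   arbitrary. *)
have /choice[A hA] : forall q : R -> R, exists G : R -> R, continuous q ->
    G 0 = 0 /\ forall t : R, -1 < t -> is_derive t 1 G (q t).
  move=> q; have [/continuous_antiderivative[G hG]|nq] := pselect (continuous q).
    by exists G.
  by exists q.
(* Negative times are frozen at 0, so that the new curve is M-Lipschitz on the whole line and can be
   fed back into the operator. *)
pose step u j (t : R) := x0 j + A (Phi_along u j) (Num.max t 0).
have A0 u j : lipschitz u -> A (Phi_along u j) 0 = 0.
  by move=> /Phi_along_continuous/(_ j)/hA[].
have dA u j (t : R) : lipschitz u -> 0 <= t ->
    is_derive t 1 (A (Phi_along u j)) (Phi_along u j t).
  move=> /Phi_along_continuous/(_ j)/hA[_ dA] t0; apply: dA.
  by apply: lt_le_trans t0; rewrite ltrN10.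
have step_lipschitz u : lipschitz u -> lipschitz (step u).
  move=> uM j s t; wlog st : s t / t <= s.
    by move=> th; case: (leP t s) => [|/ltW] /th//; rewrite distrC (distrC t).
  rewrite /step opprD addrACA subrr add0r.
  have dE (r : R) := is_derive_mull M r.
  have mst : Num.max t 0 <= Num.max s 0 by rewrite ge_max !le_max st lexx orbT.
  have pos r : Num.max t 0 <= r -> 0 <= r by rewrite ge_max => /andP[].
  have := @is_derive_ler_norm R _ _ (A (Phi_along u j)) (fun s => M * s)
    (Phi_along u j) (fun=> M) mst.
  move=> /(_ _ _ _ _ _)/le_trans; apply.
  - by move=> r /andP[/pos r0 _]; exact: is_derive1_continuous (dA _ j _ uM r0).
  - by move=> r _; exact: is_derive1_continuous (dE r).
  - by move=> r /andP[/ltW/pos r0 _]; exact: dA.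
  - by move=> r _; exact: Phi_bounded.
  rewrite -mulrBr ler_wpM2l ?(M_ge0 j)// (le_trans _ (ler_norm _))//.
  by rewrite /Num.max; do 2 case: ifP => ?; lra.
have step_contraction u w c : lipschitz u -> lipschitz w -> 0 <= c ->
    (forall j (t : R), 0 <= t -> `|u j t - w j t| <= c * expR (2 * K * t)) ->
    forall j (t : R), 0 <= t ->
      `|step u j t - step w j t| <= c / 2 * expR (2 * K * t).
  move=> uM wM c0 uw j t t0.
  rewrite /step opprD addrACA subrr add0r (max_idPl t0).
  apply: (@weighted_contraction (A (Phi_along u j) \- A (Phi_along w j))
    (fun s => Phi_along u j s - Phi_along w j s)) => //=.
  - by rewrite !A0// subrr.
  - move=> s /andP[s0 _]; apply: is_derive1_continuous.
    by apply: is_deriveB; exact: dA.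
  - by move=> s /andP[s0 _]; apply: is_deriveB; apply: dA => //; exact: ltW.
  - move=> s /andP[s0 _]; apply: Phi_lipschitz => i; apply: uw; exact: ltW.
pose iterate := fix iterate k := if k is k'.+1 then step (iterate k')
  else fun j _ => x0 j.
have iterate_lipschitz k : lipschitz (iterate k).
  elim: k => [|k ih]; last exact: step_lipschitz.
  by move=> j s t; rewrite subrr normr0 mulr_ge0// (M_ge0 j).
have cauchy k : forall j (t : R), 0 <= t ->
   `|iterate k.+1 j t - iterate k j t| <= M / K / 2 ^+ k * expR (2 * K * t).
  elim: k => [|k ih] j t t0.
    rewrite expr0 divr1; apply: le_trans (linear_le_weight (M_ge0 j) t0).
    have := iterate_lipschitz 1%N j t 0.
    rewrite subr0 [iterate 1%N j 0]/= /step maxxx A0 ?addr0; last first.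
      exact: iterate_lipschitz 0%N.
    move=> /le_trans; apply; rewrite ger0_norm//.
    by have := mulr_ge0 (M_ge0 j) t0; lra.
  rewrite exprSr invfM mulrA.
  apply: (step_contraction _ _ _ (iterate_lipschitz k.+1)
    (iterate_lipschitz k)) => //.
  by rewrite !divr_ge0 ?exprn_ge0 ?(M_ge0 j)// ltW.
have /choice[v' hv'] : forall jt : J * R, exists l : R, forall k,
    `|l - iterate k jt.1 (Num.max jt.2 0)|
      <= 2 * (M / K * expR (2 * K * Num.max jt.2 0)) / 2 ^+ k.
  move=> [j t]; apply: (@halving_limit _ (fun k => iterate k j (Num.max t 0))).
  by move=> k; rewrite mulrAC; apply: cauchy; rewrite le_max lexx orbT.
pose v j t := v' (j, t); have hv j t k : `|v j t - iterate k j (Num.max t 0)|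
    <= 2 * (M / K * expR (2 * K * Num.max t 0)) / 2 ^+ k := hv' (j, t) k.
have v_near k j t : 0 <= t ->
    `|v j t - iterate k j t| <= 2 * (M / K / 2 ^+ k) * expR (2 * K * t).
  move=> t0; have := hv j t k; rewrite /= (max_idPl t0) => /le_trans; apply.
  by rewrite le_eqVlt; apply/predU1P; left; ring.
have v_lipschitz : lipschitz v.
  move=> j s t.
  apply: (@le_halving _ _ _ (2 * (M / K * expR (2 * K * Num.max s 0)) +
    2 * (M / K * expR (2 * K * Num.max t 0)))) => k.
  have := hv j s k; have := hv j t k.
  have := iterate_lipschitz k j (Num.max s 0) (Num.max t 0).
  have := ler_wpM2l (M_ge0 j) (ler_norm_max 0 s t).
  rewrite [(_ + _) / 2 ^+ k]mulrDl.
  set p := iterate k j _; set q := iterate k j _.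
  by rewrite !ler_norml; set a := _ / 2 ^+ k; set b := _ / 2 ^+ k; lra.
(* Both v and its image lie within a multiple of 1 / 2^k of the iterate k + 1, hence they coincide
   on R_+. *)
have step_v j t : 0 <= t -> step v j t = v j t.
  move=> t0; apply/eqP; rewrite -subr_eq0 -normr_le0.
  apply/(@le_halving _ _ _ (2 * (M / K) * expR (2 * K * t))) => k.
  have vk : forall i (s : R), 0 <= s ->
      `|v i s - iterate k i s| <= 2 * (M / K / 2 ^+ k) * expR (2 * K * s).
    by move=> i s s0; exact: v_near.
  have ck : 0 <= 2 * (M / K / 2 ^+ k).
    by rewrite mulr_ge0// !divr_ge0 ?exprn_ge0 ?(M_ge0 j)// ltW.
  have := step_contraction _ _ _ v_lipschitz (iterate_lipschitz k) ck vk j t t0.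
  have := v_near k.+1 j t t0; rewrite [iterate k.+1]/= exprS add0r.
  have -> : 2 * (M / K / (2 * 2 ^+ k)) = M / K / 2 ^+ k.
    by field; rewrite expf_neq0// gt_eqF.
  have -> : 2 * (M / K / 2 ^+ k) / 2 = M / K / 2 ^+ k.
    by field; rewrite expf_neq0// gt_eqF.
  have -> : 2 * (M / K) * expR (2 * K * t) / 2 ^+ k =
      2 * (M / K / 2 ^+ k * expR (2 * K * t)).
    by ring.
  by rewrite !ler_norml; lra.
(* The fixed point v is constant on negative times and may have a corner at 0. Dropping the cut-off
   of time keeps its values on R_+ and gives a two-sided derivative at 0. *)
exists (fun j t => x0 j + A (Phi_along v j) t).
have uE j t : 0 <= t -> x0 j + A (Phi_along v j) t = v j t.
  by move=> t0; rewrite -step_v// /step (max_idPl t0).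
split=> [j|j t t0]; first by rewrite A0 ?addr0.
have -> : (fun j => x0 j + A (Phi_along v j) t) = v ^~ t.
  by apply/funext => i; rewrite uE.
rewrite -[Phi _ _]add0r; apply: is_deriveD; exact: dA.
Qed.
End Picard.

(** * Bounded Lipschitz families *)

Definition clip {R : realDomainType} (a b s : R) : R :=
  Num.min (Num.max s a) b.

Lemma clip_in {R : realDomainType} (a b s : R) :
  a <= b -> a <= clip a b s <= b.
Proof. by rewrite /clip /Num.min /Num.max => ab; do 2 case: ifP; lra. Qed.

Lemma clip_id {R : realDomainType} (a b s : R) : a <= s <= b -> clip a b s = s.
Proof. by rewrite /clip => /andP[a_s sb]; rewrite (max_idPl a_s) (min_idPl sb). Qed.

Lemma ler_norm_clip {R : realDomainType} (a b s t : R) :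
  `|clip a b s - clip a b t| <= `|s - t|.
Proof. exact: le_trans (ler_norm_min _ _ _) (ler_norm_max _ _ _). Qed.

Definition bounded_lipschitz {R : realType} (h : R -> R) : Prop :=
  exists C B, [/\ 0 <= C, forall s, `|h s| <= B &
    forall s t, `|h s - h t| <= C * `|s - t|].

(** The maximum of |h'| on the compact interval is a Lipschitz constant there, and [clip] is
    nonexpansive. *)
Lemma bounded_lipschitz_clip {R : realType} (a b : R) (h h' : R -> R) :
  a <= b ->
  (forall s, a <= s <= b -> is_derive s 1 h (h' s)) ->
  (forall s, a <= s <= b -> {for s, continuous h'}) ->
  bounded_lipschitz (fun s => h (clip a b s)).
Proof.
move=> ab dh ch.
have ch' : {within `[a, b], continuous h'}.
  by apply: continuous_in_subspaceT => u; rewrite inE/= in_itv/=; exact: ch.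
have chn : {within `[a, b], continuous (fun s => `|h' s|)}.
  by move=> s; apply: continuous_comp; [exact: ch'|exact: norm_continuous].
have [c /[!in_itv]/= cab hc] := EVT_max ab chn.
have lip s t : a <= t <= b -> a <= s <= b -> t <= s ->
    `|h s - h t| <= `|h' c| * `|s - t|.
  move=> /andP[at_ tb] /andP[as_ sb] ts.
  have dE (r : R) := is_derive_mull `|h' c| r.
  have hd r : t <= r <= s -> is_derive r 1 h (h' r).
    by move=> /andP[tr rs]; apply: dh; lra.
  have := @is_derive_ler_norm R _ _ h (fun s => `|h' c| * s) h' (fun=> `|h' c|) ts.
  rewrite -mulrBr (ger0_norm (_ : 0 <= s - t)) ?subr_ge0//.
  apply.
  - by move=> r /hd; exact: is_derive1_continuous.
  - by move=> r _; exact: is_derive1_continuous (dE r).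
  - by move=> r /andP[/ltW tr /ltW rs]; apply: hd; rewrite tr rs.
  - by move=> r /andP[tr rs]; apply: hc; rewrite in_itv/=; lra.
have lip' s t : `|h (clip a b s) - h (clip a b t)| <= `|h' c| * `|s - t|.
  apply: (@le_trans _ _ (`|h' c| * `|clip a b s - clip a b t|)); last first.
    by rewrite ler_wpM2l// ler_norm_clip.
  have [ts|/ltW st] := leP (clip a b t) (clip a b s).
    by apply: lip => //; exact: clip_in.
  by rewrite distrC (distrC (clip a b s)); apply: lip => //; exact: clip_in.
exists `|h' c|, (`|h a| + `|h' c| * (b - a)); split=> // s.
have := lip' (clip a b s) a.
rewrite [clip a b (clip _ _ _)]clip_id ?clip_in// [clip a b a]clip_id ?lexx// => ha.
rewrite -[h (clip a b s)](subrK (h a)) addrC.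
apply: le_trans (ler_normD _ _) _; rewrite lerD2l; apply: le_trans ha _.
have /andP[ac cb] := clip_in s ab.
by rewrite ler_wpM2l// ger0_norm ?subr_ge0// lerD2r.
Qed.

(* Uniformity over the index i of the family is what makes the Lipschitz
   constant of a vector field uniform over its coordinates. *)
Definition lipschitz_family {R : realType} {J I : Type}
    (phi : I -> (J -> R) -> R) : Prop :=
  exists K M, [/\ 0 <= K, 0 <= M, forall i x, `|phi i x| <= M &
    forall i x y d, 0 <= d -> (forall j, `|x j - y j| <= d) ->
      `|phi i x - phi i y| <= K * d].

Section LipschitzFamily.
Context {R : realType} {J I : Type}.
Implicit Types (phi psi : I -> (J -> R) -> R) (h : R -> R).

Lemma lipschitz_family_cst (c : R) :
  lipschitz_family (fun (_ : I) (_ : J -> R) => c).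
Proof.
exists 0, `|c|; split=> // i x y d d0 _.
by rewrite subrr normr0 mul0r.
Qed.

Lemma lipschitz_family_coord h (e : I -> J) : bounded_lipschitz h ->
  lipschitz_family (fun i x => h (x (e i))).
Proof.
move=> [C [B [C0 hB hC]]]; exists C, B; split=> //.
  exact: le_trans (normr_ge0 _) (hB 0).
by move=> i x y d d0 xy; apply: le_trans (hC _ _) _; rewrite ler_wpM2l.
Qed.

Lemma lipschitz_family_comp h phi : bounded_lipschitz h ->
  lipschitz_family phi -> lipschitz_family (fun i x => h (phi i x)).
Proof.
move=> [C [B [C0 hB hC]]] [K [M [K0 M0 phiM phiK]]].
exists (C * K), B; split=> //; first exact: mulr_ge0.
  exact: le_trans (normr_ge0 _) (hB 0).
move=> i x y d d0 xy; apply: le_trans (hC _ _) _.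
by rewrite -mulrA ler_wpM2l//; exact: phiK.
Qed.

Lemma lipschitz_familyD phi psi : lipschitz_family phi -> lipschitz_family psi ->
  lipschitz_family (fun i x => phi i x + psi i x).
Proof.
move=> [K [M [K0 M0 phiM phiK]]] [K' [M' [K'0 M'0 psiM psiK]]].
exists (K + K'), (M + M'); split=> [||i x|i x y d d0 xy]; rewrite ?addr_ge0//.
  by apply: le_trans (ler_normD _ _) _; rewrite lerD.
rewrite opprD addrACA mulrDl; apply: le_trans (ler_normD _ _) _.
by rewrite lerD//; [exact: phiK|exact: psiK].
Qed.

(** Boundedness is carried along in [lipschitz_family] for the sake of products: the usual splitting
    of the difference needs a bound on the factor left outside. *)
Lemma lipschitz_familyM phi psi : lipschitz_family phi -> lipschitz_family psi ->
  lipschitz_family (fun i x => phi i x * psi i x).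
Proof.
move=> [K [M [K0 M0 phiM phiK]]] [K' [M' [K'0 M'0 psiM psiK]]].
exists (K * M' + M * K'), (M * M'); split=> [||i x|i x y d d0 xy].
- by rewrite addr_ge0// mulr_ge0.
- by rewrite mulr_ge0.
- by rewrite normrM ler_pM.
have -> : phi i x * psi i x - phi i y * psi i y =
  (phi i x - phi i y) * psi i x + phi i y * (psi i x - psi i y) by ring.
apply: le_trans (ler_normD _ _) _; rewrite !normrM mulrDl.
rewrite mulrAC -(mulrA M) lerD// ler_pM// ?mulr_ge0//; [exact: phiK|exact: psiK].
Qed.

Lemma lipschitz_familyN phi : lipschitz_family phi ->
  lipschitz_family (fun i x => - phi i x).
Proof.
move=> hphi.
have -> : (fun i x => - phi i x) = (fun i x => -1 * phi i x).
  by apply/funext => i; apply/funext => x; rewrite mulN1r.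
exact: lipschitz_familyM (lipschitz_family_cst _) hphi.
Qed.

Lemma lipschitz_family_if (b : pred I) phi psi : lipschitz_family phi ->
  lipschitz_family psi ->
  lipschitz_family (fun i x => if b i then phi i x else psi i x).
Proof.
move=> [K [M [K0 M0 phiM phiK]]] [K' [M' [K'0 M'0 psiM psiK]]].
exists (K + K'), (M + M'); split=> [||i x|i x y d d0 xy]; rewrite ?addr_ge0//.
  by case: (b i); [apply: le_trans (phiM _ _) _|apply: le_trans (psiM _ _) _]; lra.
rewrite mulrDl; have := mulr_ge0 K0 d0; have := mulr_ge0 K'0 d0.
by case: (b i); [have := phiK i x y d d0 xy|have := psiK i x y d d0 xy]; lra.
Qed.

End LipschitzFamily.

Lemma lipschitz_family_sum {R : realType} {J I1 I2 : Type}
    (phi : I1 -> (J -> R) -> R) (psi : I2 -> (J -> R) -> R) :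
  lipschitz_family phi -> lipschitz_family psi ->
  lipschitz_family (fun i : I1 + I2 =>
    match i with inl i => phi i | inr i => psi i end).
Proof.
move=> [K [M [K0 M0 phiM phiK]]] [K' [M' [K'0 M'0 psiM psiK]]].
exists (K + K'), (M + M'); split=> [||[] i x|[] i x y d d0 xy]; rewrite ?addr_ge0//.
- by apply: le_trans (phiM _ _) _; lra.
- by apply: le_trans (psiM _ _) _; lra.
- apply: le_trans (phiK _ _ _ _ d0 xy) _; rewrite mulrDl.
  by have := mulr_ge0 K'0 d0; lra.
- apply: le_trans (psiK _ _ _ _ d0 xy) _; rewrite mulrDl.
  by have := mulr_ge0 K0 d0; lra.
Qed.

(** * The potential *)

Section Potential.
Context {R : realType}.
Variables (L lambda : R) (V : R -> R).
Hypothesis L_lt_lambda : L < lambda.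
Hypothesis V_C2 : C2_right_of L V.
Hypothesis V_ge0 : forall s, L < s -> 0 <= V s.
Hypothesis V_lim : V s @[s --> L^'+] --> +oo.
Hypothesis V_convex : forall s, L < s -> 0 <= derive1 (derive1 V) s.
Hypothesis V_zero : forall s, lambda <= s -> V s = 0.
Hypothesis V_decr : forall s, L < s < lambda -> derive1 V s < 0.

Lemma V_is_derive s : L < s -> is_derive s 1 V (derive1 V s).
Proof. by move=> /V_C2[dV _ _]; rewrite derive1E; exact: derivableP. Qed.

Lemma dV_is_derive s : L < s ->
  is_derive s 1 (derive1 V) (derive1 (derive1 V) s).
Proof.
move=> /V_C2[_ dV _]; rewrite [X in is_derive _ _ _ X]derive1E.
exact: derivableP.
Qed.

Lemma V_continuous s : L < s -> {for s, continuous V}.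
Proof. by move=> /V_is_derive/is_derive1_continuous. Qed.

(** Such an s, including [lambda] itself, is an interior minimum of V on a neighbourhood, since V >=
    0 and V(s) = 0. *)
Lemma dV_zero s : lambda <= s -> derive1 V s = 0.
Proof.
move=> ls; have Ls : L < s by exact: lt_le_trans ls.
have ab : L <= s + 1 by lra.
have [|||_ Vs0] := @derive1_at_min R V L (s + 1) s ab.
- by move=> t; rewrite in_itv/= => /andP[Lt _]; case: (V_C2 Lt) => dV _ _; exact: dV.
- by rewrite in_itv/= Ls ltrDl ltr01.
- by move=> t /[!in_itv]/= /andP[Lt _]; rewrite (V_zero ls) V_ge0.
by rewrite derive1E.
Qed.

Lemma dV_le0 s : L < s -> derive1 V s <= 0.
Proof.
move=> Ls; have [/dV_zero->//|sl] := leP lambda s.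
by rewrite ltW// V_decr// Ls.
Qed.

Lemma V_nonincreasing s t : L < s -> s <= t -> V t <= V s.
Proof.
move=> Ls st; rewrite -subr_le0 -(subrr (0 : R)).
have Lu u : s <= u -> L < u by exact: lt_le_trans.
apply: (@is_derive_ler R s t V (fun=> 0) (derive1 V) (fun=> 0)) => //.
- by move=> u /andP[/Lu Lu' _]; exact: V_continuous.
- by move=> u _; exact: cvg_cst.
- by move=> u /andP[/ltW/Lu Lu' _]; exact: V_is_derive.
- by move=> u /andP[/ltW/Lu Lu' _]; exact: dV_le0.
Qed.

Lemma dV_nondecreasing s t : L < s -> s <= t -> derive1 V s <= derive1 V t.
Proof.
move=> Ls st; rewrite -subr_ge0 -(subrr (0 : R)).
have Lu u : s <= u -> L < u by exact: lt_le_trans.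
have cdV u : s <= u <= t -> {for u, continuous (derive1 V)}.
  by move=> /andP[/Lu Lu' _]; exact: is_derive1_continuous (dV_is_derive Lu').
have ddV u : s < u < t -> is_derive u 1 (derive1 V) (derive1 (derive1 V) u).
  by move=> /andP[/ltW/Lu Lu' _]; exact: dV_is_derive.
have ddV0 u : s < u < t -> 0 <= derive1 (derive1 V) u.
  by move=> /andP[/ltW/Lu Lu' _]; exact: V_convex.
have c0 u : s <= u <= t -> {for u, continuous (fun=> 0 : R)}.
  by move=> _; exact: cvg_cst.
have d0 (u : R) : s < u < t -> is_derive u 1 (fun=> 0 : R) 0.
  by move=> _; exact: is_derive_cst.
exact: (@is_derive_ler R s t (fun=> 0) (derive1 V) (fun=> 0)
  (derive1 (derive1 V)) st c0 cdV d0 ddV ddV0).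
Qed.

(** By convexity the graph lies above its tangent at s; evaluating at [lambda], where V vanishes,
    gives V(s) <= (lambda - s) |V'(s)|. *)
Lemma V_le_dV s : L < s -> V s <= (lambda - L) * - derive1 V s.
Proof.
move=> Ls; have dV0 := dV_le0 Ls.
have [ls|/ltW sl] := leP lambda s.
  by rewrite V_zero// mulr_ge0 ?oppr_ge0// subr_ge0 ltW.
apply: (@le_trans _ _ ((lambda - s) * - derive1 V s)); last first.
  by rewrite ler_wpM2r ?oppr_ge0// lerD2l lerN2 ltW.
have Lu u : s <= u -> L < u by exact: lt_le_trans.
have dE (r : R) := is_derive_mull (derive1 V s) r.
have := @is_derive_ler R s lambda (fun u => derive1 V s * u) V
  (fun=> derive1 V s) (derive1 V) sl.
rewrite (V_zero (lexx _)) => /(_ _ _ _ _ _) bound.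
suff : derive1 V s * lambda - derive1 V s * s <= 0 - V s by lra.
apply: bound.
- by move=> u _; exact: is_derive1_continuous (dE u).
- by move=> u /andP[/Lu Lu' _]; exact: V_continuous.
- by move=> u /andP[/ltW/Lu Lu' _]; exact: V_is_derive.
- by move=> u /andP[/ltW su _]; exact: dV_nondecreasing.
Qed.

Lemma V_gt0 s : L < s < lambda -> 0 < V s.
Proof.
move=> /andP[Ls sl].
have Lu u : s <= u -> L < u by exact: lt_le_trans.
have [||c /[!in_itv]/= /andP[sc cl]] := @MVT R V (derive1 V) s lambda sl.
- by move=> u; rewrite in_itv/= => /andP[/ltW/Lu Lu' _]; exact: V_is_derive.
- apply: continuous_in_subspaceT => u; rewrite inE/= in_itv/= => /andP[/Lu Lu' _].
  exact: V_continuous.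
rewrite V_zero// sub0r => Vs; rewrite -oppr_lt0 Vs nmulr_rlt0 ?subr_gt0//.
by apply: V_decr; rewrite cl (lt_trans Ls).
Qed.

Lemma V_large (w : R) : exists l, [/\ L < l, l < lambda & w < V l].
Proof.
near L^'+ => l; exists l.
have wl : w < V l by near: l; exact: cvgry_gt.
have Ll : L < l by near: l; exact: nbhs_right_gt.
have ll : l < lambda by near: l; exact: nbhs_right_lt.
split=> //.
Unshelve. all: by end_near. Qed.
End Potential.

(** * The truncated model *)

Section ClippedField.
Context {R : realType}.
Variables (n : nat) (mu lambda vmax vstar : R) (V f : R -> R) (l : R).

(** Force and velocity are independent arguments, so that the sign estimates at the ends of [0,
    [vmax]] hold whatever the gaps are. *)
Definition acceleration (X v : R) : R :=
  - (mu + g vmax vstar f X) * (v - vstar) + X.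

(** Only the lower cut can alter the force: V' vanishes from [lambda] on, so the upper cut merely
    makes the interval compact. *)
Definition clipped_force (s : nat -> R) (i : nat) : R :=
  if i == 1%N then - derive1 V (clip l lambda (s 2%N))
  else if i == n then derive1 V (clip l lambda (s n))
  else derive1 V (clip l lambda (s i)) - derive1 V (clip l lambda (s i.+1)).

(* The coordinate [inl i] is s_i and [inr i] is v_i; the field vanishes at
   indices outside the ranges 2..n and 1..n. *)
Definition clipped_field (b : R) (x : nat + nat -> R) (j : nat + nat) : R :=
  match j with
  | inl i => if (2 <= i <= n)%N
      then clip 0 vmax (x (inr i.-1)) - clip 0 vmax (x (inr i)) else 0
  | inr i => if (1 <= i <= n)%N
      then let X := clipped_force (x \o inl) i in
        - (mu + (vmax * f (clip (- b) b X) / (vstar * (vmax - vstar)) - X / vstar))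
          * (clip 0 vmax (x (inr i)) - vstar) + X
      else 0
  end.

Definition coordinates (x : state R n) (j : nat + nat) : R :=
  match j with
  | inl i => if (2 <= i <= n)%N then gap x i else 0
  | inr i => if (1 <= i <= n)%N then vel x i else 0
  end.

(** As f is only C^1, its argument is cut off too in order to get a globally Lipschitz field; this
    third cut is inactive once b bounds the force. *)
Lemma clipped_fieldE b x i : (1 <= i <= n)%N ->
  `|clipped_force (x \o inl) i| <= b ->
  clipped_field b x (inr i) =
    acceleration (clipped_force (x \o inl) i) (clip 0 vmax (x (inr i))).
Proof.
by move=> /= -> Xb; rewrite /acceleration /g clip_id// -ler_norml.
Qed.

Hypothesis dV_zero : forall s, lambda <= s -> derive1 V s = 0.

Lemma dV_clip s : l <= s -> derive1 V (clip l lambda s) = derive1 V s.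
Proof.
move=> ls; have [sl|/ltW sl] := leP s lambda; first by rewrite clip_id// ls.
by rewrite /clip (max_idPl ls) (min_idPr sl) !dV_zero.
Qed.

Lemma clipped_forceE (x : state R n) (s : nat -> R) i :
  (2 <= n)%N -> (1 <= i <= n)%N ->
  (forall i, (2 <= i <= n)%N -> s i = gap x i) ->
  (forall i, (2 <= i <= n)%N -> l <= gap x i) ->
  clipped_force s i = force V x i.
Proof.
move=> n2 /andP[i1 i_n] sx lx; rewrite /clipped_force /force.
have gapE k : (2 <= k <= n)%N ->
    derive1 V (clip l lambda (s k)) = derive1 V (gap x k).
  by move=> kn; rewrite sx// dV_clip// lx.
case: eqP => [_|/eqP iN1]; first by rewrite gapE// leqnn.
case: eqP => [_|/eqP iNn]; first by rewrite gapE// n2 leqnn.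
by rewrite !gapE//; lia.
Qed.

Hypothesis vmax_gt0 : 0 < vmax.
Hypothesis l_lt_lambda : l < lambda.
Hypothesis dV_C1 : forall s, l <= s ->
  is_derive s 1 (derive1 V) (derive1 (derive1 V) s) /\
  {for s, continuous (derive1 (derive1 V))}.
Hypothesis f_derivable : forall x, derivable f x 1.
Hypothesis f_C1 : continuous (derive1 f).

Lemma clipped_force_family : lipschitz_family
  (fun i (x : nat + nat -> R) => clipped_force (x \o inl) i).
Proof.
have dV_bl : bounded_lipschitz (fun s => derive1 V (clip l lambda s)).
  apply: (@bounded_lipschitz_clip _ _ _ _ (derive1 (derive1 V))); first exact: ltW.
    by move=> s /andP[/dV_C1[]].
  by move=> s /andP[/dV_C1[]].
apply: lipschitz_family_if.
  by apply: lipschitz_familyN; exact: (lipschitz_family_coord (fun=> inl 2%N) dV_bl).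
apply: lipschitz_family_if.
  exact: (lipschitz_family_coord (fun=> inl n) dV_bl).
apply: lipschitz_familyD; first exact: (lipschitz_family_coord inl dV_bl).
by apply: lipschitz_familyN; exact: (lipschitz_family_coord (inl \o S) dV_bl).
Qed.

Lemma clipped_field_family b : 0 <= b -> lipschitz_family
  (fun j x => clipped_field b x j).
Proof.
move=> b0; have X_family := clipped_force_family.
have clip_bl : bounded_lipschitz (clip 0 vmax).
  apply: (@bounded_lipschitz_clip _ _ _ id (fun=> 1)); first exact: ltW.
  by move=> s _; exact: cvg_cst.
have f_bl : bounded_lipschitz (fun s => f (clip (- b) b s)).
  apply: (@bounded_lipschitz_clip _ _ _ f (derive1 f)).
  - by rewrite (@le_trans _ _ 0)// oppr_le0.
  - by move=> s _; rewrite derive1E; exact: derivableP.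
  - by move=> s _; exact: f_C1.
have v_family (e : nat -> nat) : lipschitz_family
    (fun i (x : nat + nat -> R) => clip 0 vmax (x (inr (e i)))).
  exact: (lipschitz_family_coord (inr \o e) clip_bl).
have cst (c : R) := @lipschitz_family_cst R (nat + nat) nat c.
suff : lipschitz_family (fun j x => match j with
  | inl i => (fun i (x : nat + nat -> R) => if (2 <= i <= n)%N
      then clip 0 vmax (x (inr i.-1)) - clip 0 vmax (x (inr i)) else 0) i
  | inr i => (fun i (x : nat + nat -> R) => if (1 <= i <= n)%N
      then let X := clipped_force (x \o inl) i in
        - (mu + (vmax * f (clip (- b) b X) / (vstar * (vmax - vstar)) - X / vstar))
          * (clip 0 vmax (x (inr i)) - vstar) + X else 0) i
  end x).
  by congr lipschitz_family; apply/funext => -[] i; apply/funext.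
apply: lipschitz_family_sum.
  apply: lipschitz_family_if => //; apply: lipschitz_familyD => //.
  by apply: lipschitz_familyN; exact: (v_family id).
apply: lipschitz_family_if => //; apply: lipschitz_familyD => //.
apply: lipschitz_familyM; last first.
  by apply: lipschitz_familyD => //; exact: (v_family id).
apply: lipschitz_familyN; apply: lipschitz_familyD => //.
apply: lipschitz_familyD; last by apply: lipschitz_familyN; exact: lipschitz_familyM.
apply: lipschitz_familyM => //; apply: lipschitz_familyM => //.
exact: (lipschitz_family_comp f_bl X_family).
Qed.

End ClippedField.

(** * Invariance of the velocity interval *)

Section VelocityBounds.
Context {R : realType}.
Variables (mu vmax vstar : R) (f : R -> R).
Hypothesis mu_gt0 : 0 < mu.
Hypothesis vstar_gt0 : 0 < vstar.
Hypothesis vstar_lt_vmax : vstar < vmax.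
Hypothesis f_lb : forall x, Num.max x 0 <= f x.

Let vmax_gt0 : 0 < vmax := lt_trans vstar_gt0 vstar_lt_vmax.

Let f_ge X : X <= f X /\ 0 <= f X.
Proof. by have := f_lb X; rewrite ge_max => /andP. Qed.

(** Over the common denominator the numerator is vmax f(X) - (vmax - vstar) X. For X > 0 use f(X) >=
    X, otherwise f(X) >= 0. *)
Lemma g_ge0 X : 0 <= g vmax vstar f X.
Proof.
have [fX f0] := f_ge X; have d0 : 0 < vmax - vstar by rewrite subr_gt0.
have -> : g vmax vstar f X =
    (vmax * f X - (vmax - vstar) * X) / (vstar * (vmax - vstar)).
  by rewrite /g; field; rewrite !gt_eqF.
apply: divr_ge0; last by rewrite mulr_ge0 ?ltW.
rewrite subr_ge0; have [X0|/ltW X0] := leP 0 X.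
  apply: ler_pM => //; [exact: ltW|]. by rewrite lerBlDr lerDl ltW.
by apply: (@le_trans _ _ 0); [rewrite mulr_ge0_le0// ltW|rewrite mulr_ge0// ltW].
Qed.

(** The linear term of g is made for this: vstar g(X) + X = vmax f(X) / (vmax - vstar), where X has
    cancelled and f >= 0 suffices. *)
Lemma acceleration_gt0 X v : v <= 0 -> 0 < acceleration mu vmax vstar f X v.
Proof.
move=> v0; have g0 := g_ge0 X; have [fX f0] := f_ge X.
have d0 : 0 < vmax - vstar by rewrite subr_gt0.
have -> : acceleration mu vmax vstar f X v = mu * vstar
   + vmax * f X / (vmax - vstar) + (mu + g vmax vstar f X) * - v.
  by rewrite /acceleration /g; field; rewrite !gt_eqF.
rewrite -addrA ltr_pwDl ?mulr_gt0// addr_ge0//.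
  by apply: divr_ge0; [apply: mulr_ge0 => //; exact: ltW|exact: ltW].
by apply: mulr_ge0; [rewrite addr_ge0// ltW|rewrite oppr_ge0].
Qed.

(** At v = vmax the force combines with g into - (vmax / vstar) (f(X) - X), which is nonpositive
    because f(X) >= X. *)
Lemma acceleration_lt0 X v : vmax <= v -> acceleration mu vmax vstar f X v < 0.
Proof.
move=> v_vmax; have g0 := g_ge0 X; have [fX f0] := f_ge X.
have d0 : 0 < vmax - vstar by rewrite subr_gt0.
have -> : acceleration mu vmax vstar f X v = - (mu * (vmax - vstar)
   + (vmax / vstar * (f X - X) + (mu + g vmax vstar f X) * (v - vmax))).
  by rewrite /acceleration /g; field; rewrite !gt_eqF.
rewrite oppr_lt0 ltr_pwDl ?mulr_gt0// addr_ge0//.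
  by apply: mulr_ge0; [rewrite divr_ge0// ltW|rewrite subr_ge0].
by apply: mulr_ge0; [rewrite addr_ge0// ltW|rewrite subr_ge0].
Qed.

(** The separate curve w covers both the truncated equation, whose field sees the clipped velocity,
    and the original one, where w = v. *)
Lemma velocity_bounds (t : R) (v w X : R -> R) :
  0 <= t -> 0 <= v 0 <= vmax ->
  (forall u, 0 <= u <= t ->
    is_derive u 1 v (acceleration mu vmax vstar f (X u) (w u))) ->
  (forall u, v u <= 0 -> w u <= 0) -> (forall u, vmax <= v u -> vmax <= w u) ->
  0 <= v t <= vmax.
Proof.
move=> t0 /andP[v0 v_vmax] dv w0 w_vmax; apply/andP; split.
  apply: (ge0_barrier t0 v0 dv) => u _ /ltW/w0; exact: acceleration_gt0.
rewrite -subr_ge0.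
apply: (@ge0_barrier _ t (fun u => vmax - v u)
  (fun u => - acceleration mu vmax vstar f (X u) (w u))) => //.
- by rewrite subr_ge0.
- move=> u /dv dvu; rewrite -[- acceleration _ _ _ _ _ _]add0r.
  by apply: is_deriveB; exact: dvu.
- by move=> u _; rewrite subr_lt0 oppr_gt0 => /ltW/w_vmax; exact: acceleration_lt0.
Qed.

End VelocityBounds.

(** * The derivative of W along a curve *)

Lemma is_derive_sum_seq {R : realType} {I : eqType} (r : seq I) (t : R)
    (h : I -> R -> R) (dh : I -> R) :
  (forall i, i \in r -> is_derive t 1 (h i) (dh i)) ->
  is_derive t 1 (fun u => \sum_(i <- r) h i u) (\sum_(i <- r) dh i).
Proof.
elim: r => [_|i r ih hr].
  under eq_fun do rewrite big_nil.
  by rewrite big_nil; exact: is_derive_cst.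
under eq_fun do rewrite big_cons.
rewrite big_cons; apply: is_deriveD; first by apply: hr; exact: mem_head.
by apply: ih => j jr; apply: hr; rewrite in_cons jr orbT.
Qed.

Lemma is_derive_sum_nat {R : realType} (m p : nat) (t : R)
    (h : nat -> R -> R) (dh : nat -> R) :
  (forall i, (m <= i < p)%N -> is_derive t 1 (h i) (dh i)) ->
  is_derive t 1 (fun u => \sum_(m <= i < p) h i u) (\sum_(m <= i < p) dh i).
Proof.
move=> dh'; apply: is_derive_sum_seq => i; rewrite mem_index_iota; exact: dh'.
Qed.

Lemma near_forall_range {R : realType} (m p : nat) (t : R) (P : nat -> R -> Prop) :
  (forall i, (m <= i < p)%N -> \forall u \near t, P i u) ->
  \forall u \near t, forall i, (m <= i < p)%N -> P i u.
Proof.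
move=> hP.
have : \forall u \near t, forall i : 'I_p, (m <= i)%N -> P i u.
  apply: (@filter_forall _ _ (fun (i : 'I_p) u => (m <= i)%N -> P i u) (nbhs t)
    (nbhs_filter t)) => i.
  have [mi|_] := leqP m i; last by near=> u.
  by near=> u => _; near: u; apply: hP; rewrite mi ltn_ord.
by apply: filterS => u Pu i /andP[mi ip]; exact: (Pu (Ordinal ip)).
Unshelve. all: by end_near. Qed.

Lemma entryE {R : realType} {m : nat} (w : 'rV[R]_m) (k : nat) (km : (k < m)%N) :
  entry w k = w 0 (Ordinal km).
Proof. by rewrite /entry insubT. Qed.

Lemma entry_linear {R : realType} {m : nat} (a : R) (w w' : 'rV[R]_m) (k : nat) :
  entry (a *: w + w') k = a * entry w k + entry w' k.
Proof.
by rewrite /entry; case: insubP => [j _ _|_]; rewrite ?mxE// mulr0 addr0.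
Qed.

Section WDerivative.
Context {R : realType}.
Variables (n : nat) (L vstar : R) (V rho : R -> R).
Hypothesis n_gt0 : (0 < n)%N.
Hypothesis V_derive : forall s, L < s -> is_derive s 1 V (derive1 V s).
Hypothesis dV_derive : forall s, L < s ->
  is_derive s 1 (derive1 V) (derive1 (derive1 V) s).
Hypothesis V_ge0 : forall s, L < s -> 0 <= V s.
Hypothesis rho_C1 : C1_within Rnneg rho.

Lemma H_ge0 (x : state R n) : ode_domain L x -> 0 <= H vstar V x.
Proof.
move=> Lx; apply: addr_ge0.
  by apply: mulr_ge0; [rewrite invr_ge0|apply: sumr_ge0 => i _; exact: sqr_ge0].
by rewrite big_nat; apply: sumr_ge0 => i i_n; apply: V_ge0; exact: Lx.
Qed.

(* rho is only given on R_+, so it is extended by rho(0); the product with r is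
   still differentiable at 0, where H may vanish. *)
Lemma rhoM_is_derive : exists dP : R -> R, forall r : R, 0 <= r ->
  is_derive r 1 (fun u => rho (Num.max u 0) * u) (dP r).
Proof.
have [rho' _ hrho] := rho_C1.
exists (fun r => if 0 < r then rho r * 1 + r * rho' r else rho 0) => r.
rewrite le_eqVlt => /predU1P[<-|r0].
  rewrite ltxx; apply/is_derive1_caratheodory.
  exists (fun u => rho (Num.max u 0)); split=> [z||].
  - by rewrite mulr0 !subr0.
  (* At 0 the Caratheodory factor of the product is rho(max(u, 0)) itself. Its continuity follows
     from that of the tangent extension h, which agrees with rho on R_+. *)
  - pose h u := if 0 <= u then rho u else rho 0 + u * rho' 0.
    have -> : (fun u => rho (Num.max u 0)) = (fun u => h (Num.max u 0)).
      by apply/funext => u; rewrite /h le_max lexx orbT.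
    apply: (@continuous_comp _ _ _ (fun u : R => Num.max u 0) h).
      exact: max_continuous.
    rewrite maxxx; apply: (@is_derive1_continuous _ _ _ (rho' 0)).
    apply: (@tangent_extension _ 1 rho rho'); last by rewrite lexx ltr01.
    move=> u /=; rewrite in_itv/= => /andP[u0 _].
    apply: (@has_derivative_within_subset _ _ Rnneg).
      by move=> v /=; rewrite !in_itv/= andbT => /andP[].
    by apply: hrho; rewrite /= in_itv/= u0.
  - by rewrite maxxx.
rewrite r0; apply: (@near_eq_is_derive _ _ _ (rho * id)).
  near=> u; rewrite /= (max_idPl _)//; near: u; exact: lt_le_nbhsr.
have drho : is_derive r 1 rho (rho' r).
  apply: (@has_derivative_within_interior _ Rnneg).
    by near=> u; rewrite /= in_itv/= andbT; near: u; exact: lt_le_nbhsr.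
  by apply: hrho; rewrite /= in_itv/= andbT ltW.
exact: is_deriveM.
Unshelve. all: by end_near. Qed.

(** The coefficients depend on the point and not on the curve, so the same ones serve for
    trajectories and for coordinate lines; this replaces a proof that W is differentiable as a
    function of several variables. *)
Lemma W_derivative : exists A B : state R n -> nat -> R,
  forall (c : R -> state R n) (t : R) (ds dv : nat -> R),
    ode_domain L (c t) ->
    (forall i, (2 <= i <= n)%N -> is_derive t 1 (fun u => gap (c u) i) (ds i)) ->
    (forall i, (1 <= i <= n)%N -> is_derive t 1 (fun u => vel (c u) i) (dv i)) ->
    is_derive t 1 (fun u => W vstar V rho (c u))
      (\sum_(2 <= i < n.+1) A (c t) i * ds i + \sum_(1 <= i < n.+1) B (c t) i * dv i).
Proof.
have [dP hP] := rhoM_is_derive.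
exists (fun x i => dP (H vstar V x) * derive1 V (gap x i)
    - 4 ^+ i * derive1 (derive1 V) (gap x i) * (vel x i - vstar)).
(* The velocity v_1 does not enter the cross term of W. *)
exists (fun x i => dP (H vstar V x) * (vel x i - vstar)
    - (if (2 <= i)%N then 4 ^+ i * derive1 V (gap x i) else 0)).
move=> c t ds dv Lc hs hv.
have near_domain : \forall u \near t, ode_domain L (c u).
  apply: (@near_forall_range _ 2 n.+1 _ (fun i u => L < gap (c u) i)) => i i_n.
  by apply: (cvgr_gt _ (is_derive1_continuous (hs i i_n))); exact: Lc.
have dH : is_derive t 1 (fun u => H vstar V (c u))
    (\sum_(1 <= i < n.+1) (vel (c t) i - vstar) * dv i
     + \sum_(2 <= i < n.+1) derive1 V (gap (c t) i) * ds i).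
  apply: is_deriveD.
    rewrite (_ : \sum_(_ <= i < _) _ = 2^-1 * \sum_(1 <= i < n.+1)
      2 * ((vel (c t) i - vstar) * dv i)).
      apply: is_deriveZ; apply: is_derive_sum_nat => i i_n.
      have dvi := is_deriveB (hv i i_n) (is_derive_cst vstar t 1).
      apply: (is_derive_eq (is_deriveM dvi dvi)).
      by rewrite !fctE subr0 /GRing.scale /=; ring.
    by rewrite -mulr_sumr mulrA mulVf// mul1r.
  apply: is_derive_sum_nat => i i_n.
  by apply: (@is_derive1_comp _ V); [apply: V_derive; exact: Lc|exact: hs].
have dPH := @is_derive1_comp _ _ (fun u => H vstar V (c u)) t _ _
  (hP _ (H_ge0 Lc)) dH.
have dS : is_derive t 1 (fun u => \sum_(2 <= i < n.+1) 4 ^+ i *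
      derive1 V (gap (c u) i) * (vel (c u) i - vstar))
    (\sum_(2 <= i < n.+1) (4 ^+ i * derive1 V (gap (c t) i) * dv i
     + (vel (c t) i - vstar) *
       (4 ^+ i * (derive1 (derive1 V) (gap (c t) i) * ds i)))).
  apply: is_derive_sum_nat => i i_n.
  have i_n1 : (1 <= i <= n)%N by move: i_n => /andP[/ltnW-> ].
  have dG := is_derive1_comp (dV_derive (Lc i i_n)) (hs i i_n).
  have dvi := is_deriveB (hv i i_n1) (is_derive_cst vstar t 1).
  apply: (is_derive_eq (is_deriveM (is_deriveZ (4 ^+ i) dG) dvi)).
  by rewrite !fctE subr0.
apply: (@near_eq_is_derive _ _ _ (fun u => rho (Num.max (H vstar V (c u)) 0)
    * H vstar V (c u) - \sum_(2 <= i < n.+1) 4 ^+ i *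
      derive1 V (gap (c u) i) * (vel (c u) i - vstar))).
  near=> u; rewrite /W (max_idPl _)//.
  by apply: H_ge0; near: u; exact: near_domain.
apply: (is_derive_eq (is_deriveB dPH dS)).
(* The velocity terms with i = 1 are split off, so that all remaining sums run over 2..n and can be
   compared term by term. *)
rewrite !(@big_ltn _ _ _ 1 n.+1)//= subr0.
set S1 := \sum_(_ <= i < _) _; set S2 := \sum_(_ <= i < _) _.
set S3 := \sum_(_ <= i < _) _; set S4 := \sum_(_ <= i < _) _.
set S5 := \sum_(_ <= i < _) _.
have : S4 + S5 = dP (H vstar V (c t)) * (S1 + S2) - S3.
  rewrite -!big_split/= mulr_sumr -sumrB; apply: eq_big_nat => i /andP[-> _].
  by rewrite /=; ring.
by lra.
Unshelve. all: by end_near. Qed.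

Lemma gap_affine (x v : state R n) (u : R) i :
  gap (u *: v + x) i = u * gap v i + gap x i.
Proof. exact: entry_linear. Qed.

Lemma vel_affine (x v : state R n) (u : R) i :
  vel (u *: v + x) i = u * vel v i + vel x i.
Proof. exact: entry_linear. Qed.

Lemma entry0 (m i : nat) : entry (0 : 'rV[R]_m) i = 0.
Proof. by rewrite /entry; case: insubP => // j _ _; rewrite mxE. Qed.

Lemma gap_gap_dir i j : (2 <= i <= n)%N -> (2 <= j <= n)%N ->
  gap (@gap_dir R n i) j = (j == i)%:R.
Proof.
move=> /andP[i2 i_n] /andP[j2 jn].
have jlt : (j - 2 < n.-1)%N by rewrite -subn1; lia.
rewrite /gap /= (entryE _ jlt) mxE /=.
by congr (nat_of_bool _)%:R; apply/eqP/eqP; lia.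
Qed.

Lemma vel_vel_dir i j : (1 <= i <= n)%N -> (1 <= j <= n)%N ->
  vel (@vel_dir R n i) j = (j == i)%:R.
Proof.
move=> /andP[i1 i_n] /andP[j1 jn].
have jlt : (j - 1 < n)%N by lia.
rewrite /vel /= (entryE _ jlt) mxE /=.
by congr (nat_of_bool _)%:R; apply/eqP/eqP; lia.
Qed.

Lemma sum_delta (m p i : nat) (a : nat -> R) : (m <= i < p)%N ->
  \sum_(m <= j < p) a j * (j == i)%:R = a i.
Proof.
move=> mip; rewrite (bigD1_seq i) ?mem_index_iota ?iota_uniq//= eqxx mulr1.
by rewrite big1 ?addr0// => j /negbTE->; rewrite mulr0.
Qed.

Lemma derive_line (U : state R n -> R) (x v : state R n) (D : R) :
  is_derive (0 : R) 1 (fun u : R => U (u *: v + x)) D -> 'D_v U x = D.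
Proof.
case=> _ <-; rewrite /derive /=; congr (lim _).
by under [in RHS]eq_fun do rewrite addr0 scale0r add0r [_%:A]mulr1.
Qed.

(* [W_derivative] gives both sides: applied to the lines [x + u v] it computes
   the partial derivatives of W. *)
Lemma W_orbital_derivative (mu vmax : R) (f : R -> R) (c : R -> state R n) (t : R) :
  ode_domain L (c t) ->
  (forall i, (2 <= i <= n)%N ->
    is_derive t 1 (fun u => gap (c u) i) (vel (c t) i.-1 - vel (c t) i)) ->
  (forall i, (1 <= i <= n)%N ->
    is_derive t 1 (fun u => vel (c u) i) (F mu vmax vstar V f (c t) i)) ->
  is_derive t 1 (fun u => W vstar V rho (c u))
    (orbital_derivative mu vmax vstar V f (W vstar V rho) (c t)).
Proof.
move=> Lc hs hv; have [A [B hAB]] := W_derivative.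
apply: (is_derive_eq (hAB c t _ _ Lc hs hv)).
have affine_derive (a b : R) : is_derive (0 : R) 1 (fun u => u * a + b) a.
  apply/is_derive1_caratheodory; exists (fun=> a); split=> // [u|]; first by ring.
  exact: cvg_cst.
have line0 v : 0 *: v + c t = c t by rewrite scale0r add0r.
congr (_ + _); apply: eq_big_nat => i i_n; congr (_ * _); apply/esym/derive_line.
  have := hAB (fun u => u *: gap_dir i + c t) 0 (fun j => (j == i)%:R) (fun=> 0).
  rewrite line0 sum_delta// [X in _ + X]big1 ?addr0; last first.
    by move=> j _; rewrite mulr0.
  apply=> // j j_n.
    under eq_fun do rewrite gap_affine gap_gap_dir//.
    exact: affine_derive.
  under eq_fun do rewrite vel_affine /vel entry0.
  exact: affine_derive.
have := hAB (fun u => u *: vel_dir i + c t) 0 (fun=> 0) (fun j => (j == i)%:R).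
rewrite line0 sum_delta// big1 ?add0r; last by move=> j _; rewrite mulr0.
apply=> // j j_n.
  under eq_fun do rewrite gap_affine /gap entry0.
  exact: affine_derive.
under eq_fun do rewrite vel_affine vel_vel_dir//.
exact: affine_derive.
Qed.

End WDerivative.

(** * Decay estimate *)

(** If y(t) = 0 there is nothing to prove. Otherwise y, being nonincreasing, is positive on all of
    [0, t], and 1 / y may be differentiated there. *)
Lemma inverse_decay {R : realType} (t gam : R) (y y' : R -> R) :
  0 <= t -> 0 <= gam ->
  (forall u, 0 <= u <= t -> is_derive u 1 y (y' u)) ->
  (forall u, 0 <= u <= t -> 0 <= y u) ->
  (forall u, 0 <= u <= t -> y' u <= - (gam * y u ^+ 2)) ->
  y t <= y 0 / (1 + gam * y 0 * t).
Proof.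
move=> t0 gam0 dy y_ge0 y'_le.
have y0_ge0 : 0 <= y 0 by apply: y_ge0; rewrite lexx.
have den_ge1 : 0 < 1 + gam * y 0 * t by rewrite ltr_pwDl// !mulr_ge0.
have yt_ge0 : 0 <= y t by apply: y_ge0; rewrite t0 lexx.
move: (yt_ge0); rewrite le_eqVlt => /predU1P[<-|yt_gt0].
  by rewrite divr_ge0// ltW.
have y_gt0 u : 0 <= u <= t -> 0 < y u.
  move=> /andP[u0 ut]; apply: (lt_le_trans yt_gt0).
  rewrite -subr_le0 -(subrr (0 : R)).
  have ut0 (v : R) : u <= v <= t -> 0 <= v <= t.
    by move=> /andP[uv ->]; rewrite (le_trans u0).
  apply: (@is_derive_ler R u t y (fun=> 0) y' (fun=> 0)) => //.
  - by move=> v /ut0 vt; exact: is_derive1_continuous (dy v vt).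
  - by move=> v _; exact: cvg_cst.
  - by move=> v /andP[/ltW uv /ltW vt]; apply: dy; apply: ut0; rewrite uv.
  - move=> v /andP[/ltW uv /ltW vt]; have vt' : 0 <= v <= t by apply: ut0; rewrite uv.
    by apply: le_trans (y'_le v vt') _; rewrite oppr_le0 mulr_ge0// sqr_ge0.
have dV u : 0 <= u <= t -> is_derive u 1 (fun u => (y u)^-1) (- y u ^- 2 *: y' u).
  by move=> ut; apply: is_deriveV; [rewrite gt_eqF// y_gt0|exact: dy].
have : gam * t - gam * 0 <= (y t)^-1 - (y 0)^-1.
  apply: (@is_derive_ler R 0 t (fun u => gam * u) (fun u => (y u)^-1) (fun=> gam)
    (fun u => - y u ^- 2 *: y' u)) => //.
  - by move=> u _; exact: is_derive1_continuous (is_derive_mull _ _).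
  - by move=> u ut; exact: is_derive1_continuous (dV u ut).
  - by move=> u _; exact: is_derive_mull.
  - by move=> u /andP[/ltW u0 /ltW ut]; apply: dV; rewrite u0.
  - move=> u /andP[/ltW u0 /ltW ut]; have ut' : 0 <= u <= t by rewrite u0.
    have yu := y_gt0 u ut'; rewrite /GRing.scale/= mulNr -mulrN mulrC.
    rewrite ler_pdivlMr ?exprn_gt0//.
    by rewrite lerNr y'_le.
have y0_gt0 : 0 < y 0 by apply: y_gt0; rewrite lexx.
rewrite mulr0 subr0 => h; rewrite ler_pdivlMr//.
have := ler_wpM2r (ltW (mulr_gt0 y0_gt0 yt_gt0)) h.
have -> : ((y t)^-1 - (y 0)^-1) * (y 0 * y t) = y 0 - y t.
  by field; rewrite !gt_eqF.
lra.
Qed.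

(** The factor 2 ^ size comes from iterating (a + b)^2 <= 2 a^2 + 2 b^2; any constant depending only
    on the number of terms will do. *)
Lemma sqr_sum_le {R : realType} {I : eqType} (r : seq I) (a : I -> R) :
  (\sum_(i <- r) a i) ^+ 2 <= 2 ^+ size r * \sum_(i <- r) a i ^+ 2.
Proof.
elim: r => [|i r ih]; first by rewrite !big_nil expr0n mulr0.
rewrite !big_cons /= [2 ^+ _.+1]exprS; set N := 2 ^+ size r in ih *.
set S := \sum_(j <- r) a j in ih *.
set T := \sum_(j <- r) _ in ih *.
have : (a i + S) ^+ 2 <= 2 * a i ^+ 2 + 2 * S ^+ 2.
  by have := sqr_ge0 (a i - S); rewrite !expr2; lra.
have : a i ^+ 2 <= N * a i ^+ 2.
  by rewrite ler_peMl ?sqr_ge0// exprn_ege1// ler1n.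
by lra.
Qed.

(** * The comparison functions of class KL and K_infinity *)

Section Comparison.
Context {R : realType}.
Variables (c : R) (kappa : R -> R).
Hypothesis c_gt0 : 0 < c.
Hypothesis kappa_C0 : {within Rnneg, continuous kappa}.
Hypothesis kappa_gt0 : forall r, Rnneg r -> 0 < kappa r.
Hypothesis kappa_nondecr : nondecreasing_on Rnneg kappa.

Let kap r := kappa (Num.max r 0).

(* y' <= - gam * y ^ 2 yields y t <= y 0 / (1 + gam * y 0 * t); here gam depends
   on the initial value r = y 0 because H >= W / kappa(r) along the solution. *)
Definition decay_rate (r : R) : R := c / ((1 + r) * kap r ^+ 2).

Definition decay (r t : R) : R := r / (1 + decay_rate r * r * t).

Let in_Rnneg (r : R) : Rnneg r = (0 <= r) :> Prop.
Proof. by rewrite /= in_itv/= andbT. Qed.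

Let kap_gt0 r : 0 < kap r.
Proof. by apply: kappa_gt0; rewrite in_Rnneg le_max lexx orbT. Qed.

Let kap_continuous : continuous kap.
Proof.
move=> r; have k0 : Rnneg (Num.max r 0) by rewrite in_Rnneg le_max lexx orbT.
have /subspace_continuousP/(_ _ k0) := kappa_C0.
apply: (@cvg_comp _ _ _ (fun u => Num.max u 0) kappa (nbhs r)) => P hP.
have hmax : \forall u \near r, Rnneg (Num.max u 0) -> P (Num.max u 0).
  exact: (@max_continuous R 0 r _ hP).
suff : \forall u \near r, P (Num.max u 0) by [].
near=> u; apply: (near hmax u) => //.
by rewrite in_Rnneg le_max lexx orbT.
Unshelve. all: by end_near. Qed.

Let decay_rate_gt0 r : 0 <= r -> 0 < decay_rate r.
Proof. by move=> r0; rewrite divr_gt0// mulr_gt0 ?exprn_gt0// ltr_pwDl. Qed.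

Let decay_rate_nonincr r s : 0 <= r -> r <= s -> decay_rate s <= decay_rate r.
Proof.
move=> r0 rs; have s0 := le_trans r0 rs.
rewrite ler_pM2l// lef_pV2 ?posrE ?mulr_gt0 ?exprn_gt0// ?ltr_pwDl//.
apply: ler_pM; rewrite ?addr_ge0 ?sqr_ge0 ?lerD2l//.
rewrite lerXn2r ?nnegrE ?(ltW (kap_gt0 _))//.
rewrite /kap (max_idPl r0) (max_idPl s0).
by apply: kappa_nondecr => //; rewrite in_Rnneg.
Qed.

Let den_gt0 r t : 0 <= r -> 0 <= t -> 0 < 1 + decay_rate r * r * t.
Proof.
move=> r0 t0; rewrite ltr_pwDl//; apply: mulr_ge0 => //; apply: mulr_ge0 => //.
exact/ltW/decay_rate_gt0.
Qed.

Lemma decay_continuous (p : R * R) : 0 <= p.1 -> 0 <= p.2 ->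
  {for p, continuous (fun p : R * R => decay p.1 p.2)}.
Proof.
move=> r0 t0.
have c1 : (fun q : R * R => q.1) @ p --> p.1 by exact: cvg_fst.
have c2 : (fun q : R * R => q.2) @ p --> p.2 by exact: cvg_snd.
apply: cvgM => //; apply: cvgV; first by rewrite gt_eqF// den_gt0.
apply: cvgD; first exact: cvg_cst.
apply: cvgM => //; apply: cvgM => //; apply: cvgM; first exact: cvg_cst.
apply: cvgV; first by rewrite gt_eqF// mulr_gt0 ?exprn_gt0// ltr_pwDl.
apply: cvgM; first by apply: cvgD => //; exact: cvg_cst.
have ck : (fun q : R * R => kap q.1) @ p --> kap p.1.
  by apply: continuous_cvg => //; exact: kap_continuous.
exact: cvgM.
Qed.

Lemma decay_KL : class_KL decay.
Proof.
have decay_ge0 r t : 0 <= r -> 0 <= t -> 0 <= decay r t.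
  by move=> r0 t0; rewrite divr_ge0// ltW// den_gt0.
split.
- by move=> r t; rewrite !in_Rnneg; exact: decay_ge0.
- apply: continuous_in_subspaceT => p; rewrite inE => -[]; rewrite !in_Rnneg.
  exact: decay_continuous.
- move=> t; rewrite in_Rnneg => t0; split.
  + by move=> r; rewrite in_Rnneg => /decay_ge0; exact.
  + apply: continuous_in_subspaceT => r; rewrite inE in_Rnneg => r0.
    have /= := @decay_continuous (r, t) r0 t0.
    move=> h; apply: (@continuous_comp _ _ _ (fun r : R => (r, t))
      (fun p => decay p.1 p.2)) => //.
    have ct : (fun=> t) @ r --> t by exact: cvg_cst.
    exact: (cvg_pair cvg_id ct).
  + move=> r s; rewrite !in_Rnneg => r0 s0 rs.
    (* After cross-multiplication the claim splits into r < s and a comparison of the terms in r s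
       t, which holds since the decay rate is nonincreasing in r. *)
    rewrite ltr_pdivrMr ?den_gt0// mulrAC ltr_pdivlMr ?den_gt0//.
    rewrite !mulrDr !mulr1 ltr_leD//.
    rewrite [leLHS](_ : _ = (r * s * t) * decay_rate s); last by ring.
    rewrite [leRHS](_ : _ = (r * s * t) * decay_rate r); last by ring.
    by rewrite ler_wpM2l ?mulr_ge0// decay_rate_nonincr// ltW.
  + by rewrite /decay mul0r.
- move=> r t1 t2; rewrite !in_Rnneg => r0 t10 t20 t12.
  rewrite ler_wpM2l// lef_pV2 ?posrE ?den_gt0// lerD2l.
  by rewrite ler_wpM2l// mulr_ge0// ltW// decay_rate_gt0.
- move=> r; rewrite in_Rnneg le_eqVlt => /predU1P[<-|r0].
    by rewrite /decay; under eq_fun do rewrite mul0r; exact: cvg_cst.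
  have b0 : 0 < decay_rate r * r by rewrite mulr_gt0// decay_rate_gt0// ltW.
  apply/cvgrPdist_le => e e0; near=> t.
  have t0 : 0 <= t by near: t; exact: nbhs_pinfty_ge (num_real _).
  rewrite sub0r normrN ger0_norm; last exact: decay_ge0 (ltW r0) t0.
  rewrite /decay ler_pdivrMr; last exact: den_gt0 (ltW r0) t0.
  have : r / e / (decay_rate r * r) <= t.
    by near: t; exact: nbhs_pinfty_ge (num_real _).
  rewrite ler_pdivrMr// ler_pdivrMr// => /le_trans; apply.
  by rewrite mulrDr mulr1 [leLHS]mulrC [t * _]mulrC lerDr ltW.
Unshelve. all: by end_near. Qed.

End Comparison.

(** The factor r supplies the value 0, the strict growth and the divergence, so psi need only be
    continuous, positive and nondecreasing. *)
Lemma class_Kinfty_idM {R : realType} (psi : R -> R) :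
  continuous psi -> (forall r s, r <= s -> psi r <= psi s) ->
  (forall r, 0 < r -> 0 < psi r) -> class_Kinfty (fun r => r * psi r).
Proof.
move=> cpsi mono pos.
have ge0 r : 0 <= r -> 0 <= r * psi r.
  by rewrite le_eqVlt => /predU1P[<-|r0]; rewrite ?mul0r// mulr_ge0 ?ltW ?pos.
split.
  split.
  - by move=> r /=; rewrite in_itv/= andbT; exact: ge0.
  - by apply: continuous_subspaceT => r; apply: cvgM; [exact: cvg_id|exact: cpsi].
  - move=> r s /=; rewrite !in_itv/= !andbT => r0 s0 rs.
    have s_gt0 := le_lt_trans r0 rs.
    apply: (@le_lt_trans _ _ (r * psi s)); first by rewrite ler_wpM2l// mono// ltW.
    by rewrite ltr_pM2r// pos.
  - by rewrite mul0r.
apply/cvgryPge => A; near=> r.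
have p1 : 0 < psi 1 by exact: pos.
have : A / psi 1 <= r by near: r; exact: nbhs_pinfty_ge (num_real _).
rewrite ler_pdivrMr// => /le_trans; apply.
have r1 : 1 <= r by near: r; exact: nbhs_pinfty_ge (num_real _).
by rewrite ler_wpM2l ?mono// (le_trans ler01).
Unshelve. all: by end_near. Qed.

(** * Comparison of the energy with the distance to equilibria *)

Section StateVector.
Context {R : realType}.
Variable n : nat.

Definition state_of (u : nat + nat -> R) : state R n :=
  (\row_j u (inl (j + 2)%N), \row_j u (inr (j + 1)%N)).

Lemma gap_state_of u i : (2 <= i <= n)%N -> gap (state_of u) i = u (inl i).
Proof.
move=> i_n; have i_lt : (i - 2 < n.-1)%N by lia.
by rewrite /gap (entryE _ i_lt) mxE; congr (u (inl _)) => /=; lia.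
Qed.

Lemma vel_state_of u i : (1 <= i <= n)%N -> vel (state_of u) i = u (inr i).
Proof.
move=> i_n; have i_lt : (i - 1 < n)%N by lia.
by rewrite /vel (entryE _ i_lt) mxE; congr (u (inr _)) => /=; lia.
Qed.

Lemma gap_index_ord (j : 'I_n.-1) : (2 <= j + 2 <= n)%N.
Proof. by have := ltn_ord j; lia. Qed.

Lemma gap_ord (x : state R n) (j : 'I_n.-1) : gap x (j + 2) = x.1 0 j.
Proof.
rewrite /gap addnK (entryE _ (ltn_ord j)); congr (x.1 0 _); exact: val_inj.
Qed.

Lemma vel_ord (x : state R n) (j : 'I_n) : vel x (j + 1) = x.2 0 j.
Proof.
rewrite /vel addnK (entryE _ (ltn_ord j)); congr (x.2 0 _); exact: val_inj.
Qed.

Lemma coordinatesK : cancel (coordinates (n:=n)) state_of.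
Proof.
move=> x; rewrite [RHS]surjective_pairing; congr pair; apply/rowP => j.
  by rewrite mxE /= gap_index_ord gap_ord.
by rewrite mxE /= ifT ?vel_ord//; have := ltn_ord j; lia.
Qed.

Lemma eq_state_of u w :
  (forall i, (2 <= i <= n)%N -> u (inl i) = w (inl i)) ->
  (forall i, (1 <= i <= n)%N -> u (inr i) = w (inr i)) ->
  state_of u = state_of w.
Proof.
move=> uwl uwr; congr pair; apply/rowP => j; rewrite !mxE.
  by apply: uwl; have := ltn_ord j; lia.
by apply: uwr; have := ltn_ord j; lia.
Qed.

Lemma sum_vel (x : state R n) (h : R -> R) :
  \sum_(1 <= i < n.+1) h (vel x i) = \sum_j h (x.2 0 j).
Proof.
rewrite -[1%N in LHS]add0n big_addn subn1 /= big_mkord.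
by apply: eq_bigr => j _; rewrite vel_ord.
Qed.

End StateVector.

Section Energy.
Context {R : realType}.
Variables (n : nat) (lambda L vmax vstar : R) (V : R -> R).
Hypothesis n_ge2 : (2 <= n)%N.
Hypothesis L_lt_lambda : L < lambda.
Hypothesis V_C2 : C2_right_of L V.
Hypothesis V_ge0 : forall s, L < s -> 0 <= V s.
Hypothesis V_convex : forall s, L < s -> 0 <= derive1 (derive1 V) s.
Hypothesis V_zero : forall s, lambda <= s -> V s = 0.
Hypothesis V_decr : forall s, L < s < lambda -> derive1 V s < 0.

Let sumV_ge0 (x : state R n) : Omega L vmax x ->
  0 <= \sum_(2 <= i < n.+1) V (gap x i).
Proof.
move=> [Lx _]; rewrite big_nat; apply: sumr_ge0 => i i_n.
by apply: V_ge0; exact: Lx.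
Qed.

Let sumv_ge0 (x : state R n) : 0 <= \sum_(1 <= i < n.+1) (vel x i - vstar) ^+ 2.
Proof. by apply: sumr_ge0 => i _; exact: sqr_ge0. Qed.

Lemma V_gap_le_H (x : state R n) i : Omega L vmax x -> (2 <= i <= n)%N ->
  V (gap x i) <= H vstar V x.
Proof.
move=> xO i_n; have [Lx _] := xO; have v0 := sumv_ge0 x.
apply: (@le_trans _ _ (\sum_(2 <= i < n.+1) V (gap x i))); last first.
  by rewrite lerDr mulr_ge0.
rewrite (bigD1_seq i) ?mem_index_iota ?iota_uniq//= lerDl big_seq_cond.
apply: sumr_ge0 => j; rewrite mem_index_iota => /andP[j_n _].
by apply: V_ge0; exact: Lx.
Qed.

(** With S and U the two sums in H, H^2 <= S^2 / 2 + 2 U^2. The bound V <= (lambda - L) |V'| turns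
    U^2 into a sum of V'^2, and S <= 2 H <= 2 w makes S^2 linear in S, at the price of the factor 1
    + w. *)
Lemma dissipation (b : R) : 0 < b -> exists2 c, 0 < c &
  forall (x : state R n) (w : R), Omega L vmax x -> H vstar V x <= w ->
    c * H vstar V x ^+ 2 / (1 + w) <=
      b * \sum_(1 <= i < n.+1) (vel x i - vstar) ^+ 2
      + 8^-1 * \sum_(2 <= i < n.+1) 4 ^+ i * derive1 V (gap x i) ^+ 2.
Proof.
move=> b0; pose N : R := 2 ^+ size (index_iota 2 n.+1); pose a := lambda - L.
have N0 : 0 < N by rewrite exprn_gt0.
have a0 : 0 < a by rewrite subr_gt0.
have Na0 : 0 < N * a ^+ 2 by rewrite mulr_gt0// exprn_gt0.
(* The first entry makes the velocity part fit under b S, the second one the potential part under 2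
   T. *)
exists (Num.min b (N * a ^+ 2)^-1); first by rewrite lt_min b0 invr_gt0.
move=> x w xO; have [Lx _] := xO; have := sumV_ge0 xO; have := sumv_ge0 x.
rewrite /H; set S := \sum_(_ <= i < _) (_ - _) ^+ 2.
set U := \sum_(_ <= i < _) V _; set P := \sum_(_ <= i < _) 4 ^+ i * _.
pose T := \sum_(2 <= i < n.+1) derive1 V (gap x i) ^+ 2.
move=> S0 U0 Hw.
have w0 : 0 <= w by lra.
have T0 : 0 <= T by apply: sumr_ge0 => i _; exact: sqr_ge0.
(* The indices start at 2, so 4 ^ i >= 16 and one eighth of P is at least 2 T. *)
have PT : 16 * T <= P.
  rewrite mulr_sumr; apply: ler_sum_nat => i /andP[i2 _].
  apply: ler_wpM2r; first exact: sqr_ge0.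
  rewrite (_ : 16 = 4 ^+ 2) ?ler_weXn2l ?ler1n//.
  by rewrite -natrX.
have UT : U ^+ 2 <= N * (a ^+ 2 * T).
  apply: le_trans (sqr_sum_le _ _) _; rewrite ler_wpM2l ?(ltW N0)// mulr_sumr.
  apply: ler_sum_nat => i i_n; have Li := Lx i i_n.
  rewrite -exprMn -[leRHS]sqrrN -mulrN lerXn2r ?nnegrE ?V_ge0//.
    rewrite mulr_ge0 ?(ltW a0)// oppr_ge0.
    exact: (dV_le0 L_lt_lambda V_C2 V_ge0 V_zero V_decr Li).
  exact: (V_le_dV L_lt_lambda V_C2 V_ge0 V_convex V_zero V_decr Li).
have SS : S ^+ 2 <= 2 * w * S by rewrite expr2 ler_wpM2r//; lra.
rewrite ler_pdivrMr ?ltr_pwDl//.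
set c := Num.min _ _.
have c0 : 0 <= c by rewrite le_min (ltW b0) invr_ge0 ltW.
have cb : c <= b by rewrite ge_min lexx.
have cN : c * (N * a ^+ 2) <= 1.
  by rewrite -ler_pdivlMr// div1r ge_min lexx orbT.
have H2 : (2^-1 * S + U) ^+ 2 <= (1 + w) * (S + 2 * (N * a ^+ 2 * T)).
  have X0 : 0 <= w * (N * (a ^+ 2 * T)).
    by rewrite !mulr_ge0 ?sqr_ge0// ltW.
  have := sqr_ge0 (2^-1 * S - U); move: UT SS; rewrite -mulrA !expr2.
  by move: X0; rewrite !expr2; lra.
have cS : c * S <= b * S by rewrite ler_wpM2r.
have cT : c * (N * a ^+ 2) * T <= T by rewrite ler_piMl// !mulr_ge0 ?sqr_ge0// ltW.
have : c * (2^-1 * S + U) ^+ 2 <= (1 + w) * (c * S + 2 * (c * (N * a ^+ 2) * T)).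
  apply: (le_trans (ler_wpM2l c0 H2)).
  by rewrite le_eqVlt; apply/predU1P; left; ring.
move=> /le_trans; apply; rewrite mulrC ler_wpM2r ?addr_ge0//; lra.
Qed.

Lemma Kinfty_dist_le_H : exists2 a : R -> R, class_Kinfty a &
  forall x : state R n, Omega L vmax x ->
    a (dist x (equilibria lambda vstar)) <= H vstar V x.
Proof.
pose A := lambda - L; have A0 : 0 < A by rewrite subr_gt0.
have n0 : 0 < n%:R :> R by rewrite ltr0n ltnW.
(* If dist > d, then either the velocities contribute d ^ 2 / 4 to H or some gap
   is at most lambda - q d; the cut-off at A = lambda - L keeps V defined for
   the large d that do not occur in Omega. *)
pose q (d : R) := d / (2 * n%:R).
pose Vq d := V (lambda - Num.min (q d) A / 2).
(* One term for each case. Velocities with S >= d^2 / 2 give H >= d^2 / 4. A gap deficit of at least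
   q(d), which in Omega forces q(d) <= A, gives d Vq(d) / (2 n A) = (q(d) / A) Vq(d) <= Vq(d) <=
   H. *)
pose psi d := Num.min (Vq d / (2 * n%:R * A)) (d / 4).
(* Halving the minimum keeps the argument strictly above L even when the cut-off at A is active. *)
have arg d : L < lambda - Num.min (q d) A / 2.
  have : Num.min (q d) A <= A by rewrite ge_min lexx orbT.
  by rewrite /A in A0 *; lra.
have psi_Kinfty : class_Kinfty (fun d => d * psi d).
  apply: class_Kinfty_idM.
  - have cq : continuous (fun d => lambda - Num.min (q d) A / 2).
      move=> d; apply: cvgB; first exact: cvg_cst.
      apply: cvgMl; apply: (@continuous_comp _ _ _ q (fun u => Num.min u A)).
        exact: mulrr_continuous.
      exact: min_continuous.
    move=> d.
    apply: (@continuous_min R _ (fun d => Vq d / (2 * n%:R * A)) (fun d => d / 4)).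
      apply: cvgMl.
      apply: (@continuous_comp R R R (fun d => lambda - Num.min (q d) A / 2) V d).
        exact: cq.
      exact: (V_continuous V_C2 (arg d)).
    exact: mulrr_continuous.
  - move=> d e de; rewrite le_min !ge_min ler_pM2r ?invr_gt0 ?mulr_gt0//.
    rewrite [X in _ && (_ || X)]ler_pM2r ?invr_gt0// de orbT andbT; apply/orP; left.
    apply: (V_nonincreasing L_lt_lambda V_C2 V_ge0 V_zero V_decr) => //.
    have : Num.min (q d) A <= Num.min (q e) A.
      by rewrite le_min !ge_min lexx orbT andbT ler_pM2r ?invr_gt0 ?mulr_gt0// de.
    by lra.
  - move=> d d0; rewrite lt_min !divr_gt0 ?mulr_gt0//.
    apply: (V_gt0 V_C2 V_zero V_decr); rewrite arg/=.
    have : 0 < Num.min (q d) A by rewrite lt_min A0 divr_gt0// mulr_gt0.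
    by lra.
exists (fun d => d * psi d) => //.
move=> x xO; have [Lx _] := xO.
(* Raising each gap to at least [lambda] and resetting the velocities gives an equilibrium whose
   distance to x bounds [dist] from above. *)
pose p : state R n := (\row_j Num.max (x.1 0 j) lambda, \row_j vstar).
have pS : equilibria lambda vstar p.
  split=> i i_n.
    have i_lt : (i - 2 < n.-1)%N by lia.
    by rewrite /gap (entryE _ i_lt) mxE le_max lexx orbT.
  have i_lt : (i - 1 < n)%N by lia.
  by rewrite /vel (entryE _ i_lt) mxE.
have lb0 : lbound [set enorm (x - y) | y in equilibria lambda vstar] 0.
  by move=> _ [y _ <-]; exact: sqrtr_ge0.
have d_le : dist x (equilibria lambda vstar) <= enorm (x - p).
  by apply: ge_inf; [exists 0|exists p].
have d_ge0 : 0 <= dist x (equilibria lambda vstar).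
  by apply: lb_le_inf => //; exists (enorm (x - p)); exists p.
have e_ge0 : 0 <= enorm (x - p) by exact: sqrtr_ge0.
set e := enorm (x - p) in d_le e_ge0.
apply: (@le_trans _ _ (e * psi e)).
  move: d_le; rewrite le_eqVlt => /predU1P[->//|d_lt].
  have [[_ _ mono _] _] := psi_Kinfty.
  by apply/ltW/mono => //; rewrite /= in_itv/= ?d_ge0 ?e_ge0.
have H0 : 0 <= H vstar V x.
  by rewrite addr_ge0 ?sumV_ge0// mulr_ge0.
move: (e_ge0); rewrite le_eqVlt => /predU1P[<-|e_gt0]; first by rewrite mul0r.
have eE : e ^+ 2 = \sum_j (x.1 0 j - Num.max (x.1 0 j) lambda) ^+ 2
    + \sum_(1 <= i < n.+1) (vel x i - vstar) ^+ 2.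
  rewrite sqr_sqrtr; last by rewrite addr_ge0// sumr_ge0// => j _; exact: sqr_ge0.
  rewrite (sum_vel x (fun v => (v - vstar) ^+ 2)).
  by congr (_ + _); apply: eq_bigr => j _; rewrite !mxE.
set S := \sum_(_ <= i < _) _ in eE.
have SH : S <= 2 * H vstar V x by have := sumV_ge0 xO; rewrite /H -/S; lra.
have [eS|Se] := leP (e ^+ 2 / 2) S.
  apply: (@le_trans _ _ (e * (e / 4))).
    by rewrite ler_wpM2l// ge_min lexx orbT.
  by move: eS; rewrite expr2; lra.
have qe0 : 0 < q e by rewrite divr_gt0// mulr_gt0.
(* If all gap deficits were below q(e), their squares would add up to at most n (e / 2n)^2 <= e^2 /
   4, but they exceed e^2 / 2. *)
have [j jq] : exists j, q e <= `|x.1 0 j - Num.max (x.1 0 j) lambda|.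
  apply: contrapT => /forallNP small.
  suff : \sum_j (x.1 0 j - Num.max (x.1 0 j) lambda) ^+ 2 <= e ^+ 2 / 4.
    have := exprn_gt0 2 e_gt0; move: eE Se; set E2 := e ^+ 2; lra.
  apply: (@le_trans _ _ (\sum_(j < n.-1) q e ^+ 2)).
    apply: ler_sum => j _; have /negP := small j; rewrite -ltNge => /ltW jq.
    by rewrite -[leLHS]real_normK ?num_real// lerXn2r// nnegrE ltW.
  rewrite sumr_const card_ord -[_ *+ n.-1]mulr_natl.
  apply: (@le_trans _ _ (n%:R * q e ^+ 2)).
    by rewrite ler_wpM2r ?sqr_ge0// ler_nat leq_pred.
  have -> : n%:R * q e ^+ 2 = e ^+ 2 / 4 * n%:R^-1.
    by rewrite /q; field; rewrite gt_eqF.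
  by rewrite ler_piMr ?divr_ge0 ?sqr_ge0// invf_le1// ler1n ltnW.
have xj : L < x.1 0 j by rewrite -gap_ord; apply: Lx; exact: gap_index_ord.
have qj : q e <= lambda - x.1 0 j.
  move: jq; rewrite /Num.max; case: ifPn => [xl|_].
    by rewrite distrC ger0_norm// subr_ge0 ltW.
  by rewrite subrr normr0 => /(lt_le_trans qe0); rewrite ltxx.
have VH : Vq e <= H vstar V x.
  apply: (@le_trans _ _ (V (gap x (j + 2)))); last first.
    exact: V_gap_le_H xO (gap_index_ord j).
  rewrite gap_ord.
  apply: (V_nonincreasing L_lt_lambda V_C2 V_ge0 V_zero V_decr) => //.
  have : Num.min (q e) A <= q e by rewrite ge_min lexx.
  by lra.
apply: le_trans VH; apply: (@le_trans _ _ (e * (Vq e / (2 * n%:R * A)))).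
  by rewrite ler_wpM2l// ge_min lexx.
have -> : e * (Vq e / (2 * n%:R * A)) = q e / A * Vq e.
  by rewrite /q; field; rewrite !gt_eqF.
apply: ler_piMl; first by apply: V_ge0; exact: arg.
by rewrite ler_pdivrMr// mul1r (le_trans qj)// lerD2l lerN2 ltW.
Qed.

End Energy.

(** * Trajectories *)

Section Trajectories.
Context {R : realType}.
Variables (n : nat) (mu lambda L vmax vstar : R) (V f : R -> R).
Hypothesis n_ge2 : (2 <= n)%N.
Hypothesis L_lt_lambda : L < lambda.
Hypothesis V_C2 : C2_right_of L V.
Hypothesis V_ge0 : forall s, L < s -> 0 <= V s.
Hypothesis V_zero : forall s, lambda <= s -> V s = 0.
Hypothesis V_decr : forall s, L < s < lambda -> derive1 V s < 0.
Variables (c b : R) (rho kappa : R -> R).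
Hypothesis c_gt0 : 0 < c.
Hypothesis rho_C1 : C1_within Rnneg rho.
Hypothesis kappa_gt0 : forall r, Rnneg r -> 0 < kappa r.
Hypothesis kappa_nondecr : nondecreasing_on Rnneg kappa.
Hypothesis W_bounds : forall x : state R n, Omega L vmax x ->
  H vstar V x <= W vstar V rho x <= kappa (H vstar V x) * H vstar V x.
Hypothesis W_dissipation : forall (x : state R n) (w : R),
  Omega L vmax x -> H vstar V x <= w ->
  orbital_derivative mu vmax vstar V f (W vstar V rho) x <=
    - (c * H vstar V x ^+ 2 / (1 + w)).

(** The model with two-sided derivatives, also at time 0, as the comparison lemmas require. *)
Definition model_at (x : R -> state R n) (t : R) : Prop :=
  (forall i, (2 <= i <= n)%N ->
    is_derive t 1 (fun u => gap (x u) i) (vel (x t) i.-1 - vel (x t) i)) /\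
  (forall i, (1 <= i <= n)%N ->
    is_derive t 1 (fun u => vel (x u) i) (F mu vmax vstar V f (x t) i)).

Lemma Omega_H_ge0 (x : state R n) : Omega L vmax x -> 0 <= H vstar V x.
Proof. by move=> [Lx _]; exact: (H_ge0 _ V_ge0). Qed.

Lemma W_sublevel_gap (x : state R n) (l : R) i : Omega L vmax x -> L < l ->
  W vstar V rho x < V l -> (2 <= i <= n)%N -> l < gap x i.
Proof.
move=> xO Ll Wl i_n; rewrite ltNge; apply/negP => gl.
have Lg : L < gap x i by case: xO => Lx _; exact: Lx.
have := V_nonincreasing L_lt_lambda V_C2 V_ge0 V_zero V_decr Lg gl.
have := V_gap_le_H vstar V_ge0 xO i_n; have /andP[HW _] := W_bounds xO; lra.
Qed.

(** The dissipation bound is used twice. With w = H it yields only a sign, hence W <= W(0); this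
    makes w = W(0) admissible at all times, so that the rate becomes uniform. Then W <= kappa(W(0))
    H turns H^2 into W^2 / kappa(W(0))^2. *)
Lemma W_decay_along (x : R -> state R n) (t : R) : 0 <= t ->
  (forall u, 0 <= u <= t -> Omega L vmax (x u)) ->
  (forall u, 0 <= u <= t -> model_at x u) ->
  W vstar V rho (x t) <= W vstar V rho (x 0) /\
  W vstar V rho (x t) <= decay c kappa (W vstar V rho (x 0)) t.
Proof.
move=> t0 xO xm; pose y u := W vstar V rho (x u).
pose y' u := orbital_derivative mu vmax vstar V f (W vstar V rho) (x u).
have dy u : 0 <= u <= t -> is_derive u 1 y (y' u).
  move=> ut; have [hs hv] := xm u ut.
  have [Lx _] := xO u ut.
  exact: (W_orbital_derivative (ltnW n_ge2) (V_is_derive V_C2) (dV_is_derive V_C2)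
    V_ge0 rho_C1 Lx hs hv).
have y_ge0 u : 0 <= u <= t -> 0 <= y u.
  move=> /xO xuO; have /andP[HW _] := W_bounds xuO.
  exact: le_trans (Omega_H_ge0 xuO) HW.
have y_le0 u : 0 <= u <= t -> y u <= y 0.
  move=> /andP[u0 ut].
  suff : y u - y 0 <= (fun=> 0) u - (fun=> 0) (0 : R) :> R.
    by rewrite subrr subr_le0.
  have vt v : 0 <= v <= u -> 0 <= v <= t by move=> /andP[-> /le_trans->].
  apply: (@is_derive_ler R 0 u y (fun=> 0) y' (fun=> 0)) => //.
  - by move=> v /vt/dy; exact: is_derive1_continuous.
  - by move=> v _; exact: cvg_cst.
  - by move=> v /andP[/ltW v0 /ltW vu]; apply/dy/vt; rewrite v0.
  - move=> v /andP[/ltW v0 /ltW vu]; have xvO : Omega L vmax (x v).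
      by apply/xO/vt; rewrite v0.
    apply: le_trans (W_dissipation xvO (lexx _)) _; rewrite oppr_le0.
    have H0 := Omega_H_ge0 xvO.
    apply: divr_ge0; last exact: addr_ge0.
    by apply: mulr_ge0; [exact: ltW|exact: sqr_ge0].
split; first by apply: y_le0; rewrite t0 lexx.
have w0 : 0 <= y 0 by apply: y_ge0; rewrite lexx.
have kap0 : 0 < kappa (y 0) by apply: kappa_gt0; rewrite /= in_itv/= andbT.
have rateE : decay_rate c kappa (y 0) = c / ((1 + y 0) * kappa (y 0) ^+ 2).
  by rewrite /decay_rate (max_idPl w0).
apply: (@inverse_decay _ t (decay_rate c kappa (y 0)) y y') => //.
  rewrite rateE; apply: divr_ge0; first exact: ltW.
  by apply: mulr_ge0; [exact: addr_ge0|exact: sqr_ge0].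
move=> u ut; have xuO := xO u ut; have /andP[HW Wk] := W_bounds xuO.
have Hw : H vstar V (x u) <= y 0 by exact: le_trans HW (y_le0 u ut).
apply: le_trans (W_dissipation xuO Hw) _; rewrite lerN2 rateE.
have H0 := Omega_H_ge0 xuO.
have yk : y u <= kappa (y 0) * H vstar V (x u).
  apply: le_trans Wk _; rewrite ler_wpM2r//.
  by apply: kappa_nondecr => //; rewrite /= in_itv/= andbT.
have : y u ^+ 2 <= kappa (y 0) ^+ 2 * H vstar V (x u) ^+ 2.
  by rewrite -exprMn lerXn2r ?nnegrE ?y_ge0// mulr_ge0// ltW.
rewrite -ler_pdivrMl ?exprn_gt0// => yH.
rewrite (_ : c / _ * _ =
  c * ((kappa (y 0) ^+ 2)^-1 * y u ^+ 2) / (1 + y 0)); last first.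
  by field; rewrite !gt_eqF// ltr_pwDl.
apply: ler_wpM2r; first by rewrite invr_ge0 addr_ge0.
by apply: ler_wpM2l => //; exact: ltW.
Qed.

Hypothesis mu_gt0 : 0 < mu.
Hypothesis vstar_gt0 : 0 < vstar.
Hypothesis vstar_lt_vmax : vstar < vmax.
Hypothesis V_lim : V s @[s --> L^'+] --> +oo.
Hypothesis f_derivable : forall x, derivable f x 1.
Hypothesis f_C1 : continuous (derive1 f).
Hypothesis f_lb : forall x, Num.max x 0 <= f x.

Let vmax_gt0 : 0 < vmax := lt_trans vstar_gt0 vstar_lt_vmax.

Let range_pred i : (2 <= i <= n)%N -> (1 <= i <= n)%N /\ (1 <= i.-1 <= n)%N.
Proof. by lia. Qed.

Lemma model_solution (x0 : state R n) : Omega L vmax x0 ->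
  exists x : R -> state R n,
    [/\ x 0 = x0, forall t, 0 <= t -> Omega L vmax (x t),
      forall t, 0 <= t -> model_at x t &
      forall (T : R) (y : R -> state R n), 0 < T ->
        is_solution L mu vmax vstar V f `[0, T[%classic y -> y 0 = x0 ->
        forall t, 0 <= t < T -> y t = x t].
Proof.
move=> x0O; have [l [Ll ll wl]] := V_large L_lt_lambda V_lim (W vstar V rho x0).
have Lls s : l <= s -> L < s by exact: lt_le_trans.
have dV_C1 s : l <= s -> is_derive s 1 (derive1 V) (derive1 (derive1 V) s) /\
    {for s, continuous (derive1 (derive1 V))}.
  by move=> /Lls Ls; split; [exact: (dV_is_derive V_C2 Ls)|have [] := V_C2 Ls].
have dV0 := dV_zero L_lt_lambda V_C2 V_ge0 V_zero.
(* The uniform bound of the clipped force is the cut-off level for the argument of f, so that cut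
   never acts. *)
have [_ [bd [_ bd0 force_bd _]]] := clipped_force_family n ll dV_C1.
have [K [M [K0 M0 PhiM PhiK]]] :=
  clipped_field_family n mu vstar vmax_gt0 ll dV_C1 f_derivable f_C1 bd0.
pose Phi := clipped_field n mu lambda vmax vstar V f l bd.
(* K is only known to be nonnegative, while the Picard weight needs a positive constant. *)
have K1 : 0 < K + 1 by rewrite ltr_wpDl.
have PhiK1 z w d : (forall j, `|z j - w j| <= d) ->
    forall j, `|Phi z j - Phi w j| <= (K + 1) * d.
  move=> zw j; have d0 : 0 <= d := le_trans (normr_ge0 _) (zw j).
  by apply: le_trans (PhiK j _ _ _ d0 zw) _; rewrite ler_wpM2r// lerDl.
have Phi_bounded z j : `|Phi z j| <= M by exact: PhiM.
have [u [u0 du]] := picard_exists K1 Phi_bounded PhiK1 (coordinates x0).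
have accE z i : (1 <= i <= n)%N -> Phi z (inr i) = acceleration mu vmax vstar f
    (clipped_force n lambda V l (z \o inl) i) (clip 0 vmax (z (inr i))).
  by move=> i_n; apply: clipped_fieldE => //; exact: force_bd.
have clip_le0 (v : R) : v <= 0 -> clip 0 vmax v <= 0.
  by move=> v0; rewrite /clip (max_idPr v0) ge_min lexx.
have clip_vmax (v : R) : vmax <= v -> vmax <= clip 0 vmax v.
  by move=> v_vmax; rewrite /clip le_min lexx le_max v_vmax.
(* This comes before any control of the gaps: [velocity_bounds] accepts an arbitrary force. *)
have vel_bounds i t : (1 <= i <= n)%N -> 0 <= t -> 0 <= u (inr i) t <= vmax.
  move=> i_n t0.
  apply: (@velocity_bounds _ mu vmax vstar f mu_gt0 vstar_gt0 vstar_lt_vmax f_lb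
    t (u (inr i)) (fun s => clip 0 vmax (u (inr i) s))
    (fun s => clipped_force n lambda V l ((u ^~ s) \o inl) i)) => //.
  - by rewrite u0 /= i_n; case: x0O => _; apply.
  - by move=> s /andP[s0 _]; rewrite -accE//; exact: du.
  - by move=> s; exact: clip_le0.
  - by move=> s; exact: clip_vmax.
pose x t := state_of n (u ^~ t).
(* Where no cut-off acts, the truncated field is the model. This serves the constructed trajectory
   and later the competing one. *)
have Phi_model (z : nat + nat -> R) (X : state R n) :
    (forall i, (2 <= i <= n)%N -> z (inl i) = gap X i) ->
    (forall i, (1 <= i <= n)%N -> z (inr i) = vel X i) ->
    (forall i, (2 <= i <= n)%N -> l <= gap X i) ->
    (forall i, (1 <= i <= n)%N -> 0 <= vel X i <= vmax) ->
    (forall i, (2 <= i <= n)%N -> Phi z (inl i) = vel X i.-1 - vel X i) /\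
    (forall i, (1 <= i <= n)%N -> Phi z (inr i) = F mu vmax vstar V f X i).
  move=> zl zr lX vX; split=> i i_n.
    have [i_n1 i_n2] := range_pred i_n.
    by rewrite /Phi /= i_n (zr _ i_n1) (zr _ i_n2) (clip_id (vX _ i_n1))
      (clip_id (vX _ i_n2)).
  by rewrite (accE _ _ i_n) (zr _ i_n) (clip_id (vX i i_n))
    (clipped_forceE dV0 n_ge2 i_n zl lX).
have x_model t : 0 <= t -> (forall i, (2 <= i <= n)%N -> l <= u (inl i) t) ->
    Omega L vmax (x t) /\ model_at x t.
  move=> t0 lu.
  have lx i : (2 <= i <= n)%N -> l <= gap (x t) i.
    by move=> i_n; rewrite gap_state_of// lu.
  have vx i : (1 <= i <= n)%N -> 0 <= vel (x t) i <= vmax.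
    by move=> i_n; rewrite vel_state_of// vel_bounds.
  have [Phil Phir] := Phi_model (u ^~ t) (x t)
    (fun i i_n => esym (gap_state_of _ i_n))
    (fun i i_n => esym (vel_state_of _ i_n)) lx vx.
  split; first by split=> // i i_n; exact: lt_le_trans (lx i i_n).
  split=> i i_n.
    under eq_fun do rewrite gap_state_of//.
    by rewrite -Phil//; exact: du.
  under eq_fun do rewrite vel_state_of//.
  by rewrite -Phir//; exact: du.
have x0E : x 0 = x0.
  rewrite -[RHS]coordinatesK; apply: eq_state_of => i i_n; exact: u0.
have u_gt t i : 0 <= t -> (2 <= i <= n)%N -> l < u (inl i) t.
  move=> t0 i_n; have i_lt : (i < n.+1)%N by case/andP: i_n.
  (* [gt_barrier] needs a finite index type: the ordinals below n + 1, restricted to the gap indices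
     2..n. *)
  pose P (j : 'I_n.+1) := (2 <= j)%N.
  suff : forall t, 0 <= t -> forall j, P j -> l < u (inl (j : nat)) t.
    by move=> /(_ t t0 (Ordinal i_lt)); apply; case/andP: i_n.
  apply: (@gt_barrier _ _ P (fun j => u (inl (j : nat)))).
  - by move=> j s _ s0; exact: is_derive1_continuous (du (inl (j : nat)) s s0).
  - move=> j j2; have j_n : (2 <= j <= n)%N.
      by rewrite -[(j <= n)%N]ltnS ltn_ord andbT.
    by rewrite u0 /= j_n; exact: W_sublevel_gap x0O Ll wl j_n.
  - move=> s s0 lus j j2; have j_n : (2 <= j <= n)%N.
      by rewrite -[(j <= n)%N]ltnS ltn_ord andbT.
    have xm r : 0 <= r <= s -> Omega L vmax (x r) /\ model_at x r.
      move=> rs; have /andP[r0 _] := rs; apply: x_model => // k k_n.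
      have k_lt : (k < n.+1)%N by case/andP: k_n.
      by apply: (lus r rs (Ordinal k_lt)); case/andP: k_n.
    rewrite -(gap_state_of (u ^~ s) j_n).
    have xsO : Omega L vmax (x s) by have [] := xm s; rewrite ?s0 ?lexx.
    apply: (W_sublevel_gap xsO Ll _ j_n); apply: le_lt_trans wl; rewrite -x0E.
    by have [] := W_decay_along s0 (fun r rs => (xm r rs).1)
      (fun r rs => (xm r rs).2).
have xm t : 0 <= t -> Omega L vmax (x t) /\ model_at x t.
  by move=> t0; apply: x_model => // i i_n; rewrite ltW// u_gt.
exists x; split=> //; [by move=> t /xm[]|by move=> t /xm[]|].
move=> T y T0 y_sol y0.
pose h j t := coordinates (y t) j.
pose dh (j : nat + nat) t := match j with
  | inl i => if (2 <= i <= n)%N then vel (y t) i.-1 - vel (y t) i else 0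
  | inr i => if (1 <= i <= n)%N then F mu vmax vstar V f (y t) i else 0 end.
have hd j t : `[0, T[%classic t -> has_derivative_within `[0, T[ (h j) t (dh j t).
  move=> tT; have [_ hs hv] := y_sol t tT; rewrite /h /dh.
  by case: j => i /=; case: ifPn => [i_n|_];
    [exact: hs|apply: is_derive_within; exact: is_derive_cst
    |exact: hv|apply: is_derive_within; exact: is_derive_cst].
pose z j t := if 0 <= t then h j t else h j 0 + t * dh j 0.
have dz j t : 0 <= t < T -> is_derive t 1 (z j) (dh j t).
  exact: (tangent_extension (hd j)).
pose Y t := state_of n (z ^~ t).
have zE t : 0 <= t -> z ^~ t = coordinates (y t).
  by move=> t0; apply/funext => j; rewrite /z t0.
have YE t : 0 <= t -> Y t = y t by move=> t0; rewrite /Y zE// coordinatesK.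
have Ym t : 0 <= t < T -> model_at Y t.
  move=> tT; have /andP[t0 _] := tT; rewrite /model_at (YE t t0); split=> i i_n.
    under eq_fun do rewrite gap_state_of//.
    by apply: (is_derive_eq (dz (inl i) t tT)); rewrite /= i_n.
  under eq_fun do rewrite vel_state_of//.
  by apply: (is_derive_eq (dz (inr i) t tT)); rewrite /= i_n.
have ltT s t : 0 <= t < T -> 0 <= s <= t -> 0 <= s < T.
  by move=> /andP[_ tT] /andP[-> /le_lt_trans->].
have YO t : 0 <= t < T -> Omega L vmax (Y t).
  move=> tT; have /andP[t0 _] := tT; split.
    by have [+ _ _] := y_sol t tT; rewrite YE.
  move=> i i_n; rewrite vel_state_of//.
  (* The competitor solves the equation without truncation, so the velocity seen by the field is z
     itself. *)
  apply: (@velocity_bounds _ mu vmax vstar f mu_gt0 vstar_gt0 vstar_lt_vmax f_lb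
    t (z (inr i)) (z (inr i)) (fun s => force V (y s) i)) => //.
    by rewrite /z lexx /h y0 /= i_n; case: x0O => _; apply.
  move=> s st; have sT := ltT s t tT st; have /andP[s0 _] := st.
  apply: (is_derive_eq (dz (inr i) s sT)).
  by rewrite /= i_n /z s0 /h /= i_n.
(* The competitor lies in Omega and W does not increase along it, so its gaps stay above the same l
   and no cut-off acts on it. *)
have dhE j t : 0 <= t < T -> dh j t = Phi (z ^~ t) j.
  move=> tT; have /andP[t0 _] := tT; have [_ vY] := YO t tT.
  have lY i : (2 <= i <= n)%N -> l < gap (Y t) i.
    apply: (W_sublevel_gap (YO t tT) Ll); apply: le_lt_trans wl.
    rewrite -y0 -(YE 0 (lexx 0)).
    by have [] := W_decay_along t0 (fun s st => YO s (ltT s t tT st))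
      (fun s st => Ym s (ltT s t tT st)).
  have [Phil Phir] := Phi_model (z ^~ t) (Y t)
    (fun i i_n => esym (gap_state_of _ i_n)) (fun i i_n => esym (vel_state_of _ i_n))
    (fun i i_n => ltW (lY i i_n)) vY.
  case: j => i; rewrite /dh -(YE t t0); case: ifPn => i_n.
  - by rewrite (Phil _ i_n).
  - by rewrite /Phi /= (negbTE i_n).
  - by rewrite (Phir _ i_n).
  - by rewrite /Phi /= (negbTE i_n).
have dzPhi j t : 0 <= t < T -> is_derive t 1 (z j) (Phi (z ^~ t) j).
  by move=> tT; rewrite -(dhE j t tT); exact: dz.
have duT j t : 0 <= t < T -> is_derive t 1 (u j) (Phi (u ^~ t) j).
  by move=> /andP[t0 _]; exact: du.
have zu0 j : z j 0 = u j 0 by rewrite u0 /z lexx /h y0.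
have zu := picard_unique K1 Phi_bounded PhiK1 zu0 dzPhi duT.
move=> t tT; have /andP[t0 _] := tT; rewrite -(YE t t0).
by apply: eq_state_of => i _; [exact: (zu (inl i) t tT)|exact: (zu (inr i) t tT)].
Qed.

End Trajectories.

(** * The two-sided estimate of W along solutions *)

Unset Implicit Arguments.

Theorem theorem2p3 (R : realType) (n : nat)
    (mu lambda L vmax vstar : R) (V f : R -> R)
    (hn : (2 <= n)%N)
    (hmu : 0 < mu)
    (hL : 0 < L) (hlambda : L < lambda)
    (hvstar : 0 < vstar) (hvmax : vstar < vmax)
    (V_C2 : C2_right_of L V)
    (V_ge0 : forall s, L < s -> 0 <= V s)
    (V_lim : V s @[s --> L^'+] --> +oo)
    (V_convex : forall s, L < s -> 0 <= derive1 (derive1 V) s)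
    (V_zero : forall s, lambda <= s -> V s = 0)
    (V_decr : forall s, L < s < lambda -> derive1 V s < 0)
    (f_derivable : forall x, derivable f x 1)
    (f_C1 : continuous (derive1 f))
    (f_nondecr : {homo f : x y / x <= y})
    (f_lb : forall x, Num.max x 0 <= f x)
    (beta : R) (hbeta : 0 < beta)
    (rho kappa : R -> R)
    (rho_C1 : C1_within Rnneg rho)
    (rho_gt0 : forall r, Rnneg r -> 0 < rho r)
    (rho_nondecr : nondecreasing_on Rnneg rho)
    (kappa_C0 : {within Rnneg, continuous kappa})
    (kappa_gt0 : forall r, Rnneg r -> 0 < kappa r)
    (kappa_nondecr : nondecreasing_on Rnneg kappa)
    (W_bounds : forall x : state R n, Omega L vmax x ->
       H vstar V x <= W vstar V rho x
         <= kappa (H vstar V x) * H vstar V x)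
    (W_decay : forall x : state R n, Omega L vmax x ->
       orbital_derivative mu vmax vstar V f (W vstar V rho) x
         <= - beta * mu * \sum_(1 <= i < n.+1) (vel x i - vstar) ^+ 2
            - 8^-1 * \sum_(2 <= i < n.+1) 4 ^+ i * (derive1 V (gap x i)) ^+ 2) :
  exists (sigma : R -> R -> R) (a : R -> R),
    [/\ class_KL sigma, class_Kinfty a &
      forall x0 : state R n, Omega L vmax x0 ->
        exists x : R -> state R n,
          [/\ is_solution L mu vmax vstar V f Rnneg x /\ x 0 = x0,
              forall (T : R) (y : R -> state R n), 0 < T ->
                is_solution L mu vmax vstar V f `[0, T[%classic y ->
                y 0 = x0 ->
                forall t, 0 <= t < T -> y t = x t
            & forall t, 0 <= t ->
                [/\ Omega L vmax (x t),
                    a (dist (x t) (equilibria lambda vstar))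
                      <= W vstar V rho (x t)
                  & W vstar V rho (x t) <= sigma (W vstar V rho x0) t]]].
Proof.
have bm : 0 < beta * mu by exact: mulr_gt0.
have [c c0 hc] :=
  dissipation n vmax vstar hlambda V_C2 V_ge0 V_convex V_zero V_decr bm.
have [a a_Kinfty ha] :=
  Kinfty_dist_le_H vmax vstar hn hlambda V_C2 V_ge0 V_zero V_decr.
have W_diss (x : state R n) (w : R) : Omega L vmax x -> H vstar V x <= w ->
    orbital_derivative mu vmax vstar V f (W vstar V rho) x <=
      - (c * H vstar V x ^+ 2 / (1 + w)).
  move=> xO Hw; apply: le_trans (W_decay x xO) _.
  by rewrite !mulNr -opprD lerN2; exact: hc.
exists (decay c kappa), a; split=> [||x0 x0O].
- exact: decay_KL.
- exact: a_Kinfty.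
have [x [x0E xO xm xu]] := model_solution hn hlambda V_C2 V_ge0 V_zero V_decr
  c0 rho_C1 kappa_gt0 kappa_nondecr W_bounds W_diss hmu hvstar hvmax V_lim
  f_derivable f_C1 f_lb x0O.
exists x; split; [split=> //|exact: xu|].
- move=> t; rewrite /= in_itv/= andbT => t0; have [hs hv] := xm t t0; split.
  + by case: (xO t t0).
  + by move=> i i_n; apply: is_derive_within; exact: hs.
  + by move=> i i_n; apply: is_derive_within; exact: hv.
- move=> t t0; split; first exact: xO.
    have /andP[HW _] := W_bounds _ (xO t t0).
    exact: le_trans (ha _ (xO t t0)) HW.
  have [_] := W_decay_along hn V_C2 V_ge0 c0 rho_C1
    kappa_gt0 kappa_nondecr W_bounds W_diss t0
    (fun u ut => xO u (proj1 (andP ut))) (fun u ut => xm u (proj1 (andP ut))).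
  by rewrite x0E.
Qed.
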